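(* Let $\beta=(\beta_n)_{n\ge 0}$ be a sequence of positive numbers with $\liminf_{n\to\infty}\beta_n^{1/n}\ge 1$, and for $a\in\mathbb{D}$ let $T_a(z)=\dfrac{a+z}{1+\bar a z}$. The following assertions are equivalent: 1) for some $a\in\mathbb{D}\setminus\{0\}$, the map $T_a$ induces a bounded composition operator $C_{T_a}$ on $H^2(\beta)$; 2) for all $a\in\mathbb{D}$, the map $T_a$ induces a bounded composition operator $C_{T_a}$ on $H^2(\beta)$; 3) $\beta$ is slowly oscillating.
   Context: $\mathbb{D}$ is the open unit disk of $\mathbb{C}$. For a sequence $\beta=(\beta_n)_{n\ge0}$ of positive numbers with $\liminf_{n\to\infty}\beta_n^{1/n}\ge1$, $H^2(\beta)$ is the Hilbert space of analytic functions $f(z)=\sum_{n\ge0}a_nz^n$ on $\mathbb{D}$ such that $\|f\|^2=\sum_{n\ge0}|a_n|^2\beta_n<\infty$. For an analytic self-map $\varphi:\mathbb{D}\to\mathbb{D}$, $C_\varphi(f)=f\circ\varphi$; it is bounded on $H^2(\beta)$ if it maps $H^2(\beta)$ boundedly into itself. The sequence $\beta$ is slowly oscillating if there are constants $0<c<1<C$ such that $c\le\beta_m/\beta_n\le C$ whenever $n/2\le m\le 2n$. *)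

(* Defs.v *)
(* Stdlib reals, with Coquelicot for complex numbers, series and limits. *)
From Stdlib Require Import Reals.
From Coquelicot Require Import Coquelicot.

Open Scope R_scope.

Definition unit_disk (z : C) : Prop := Cmod z < 1.

(* The term n = 0 of the sequence of roots is a junk value, which does not
   affect the liminf. *)
Definition admissible_weight (beta : nat -> R) : Prop :=
  (forall n, 0 < beta n) /\
  Rbar_le 1 (LimInf_seq (fun n => Rpower (beta n) (/ INR n))).

(* Functions on the disk are represented by total functions [C -> C]; every
   notion below depends only on their values on [unit_disk]. *)
Definition is_disk_expansion (f : C -> C) (a : nat -> C) : Prop :=
  forall z : C, unit_disk z ->
    @is_pseries C_AbsRing C_NormedModule a z (f z).

Definition in_H2 (beta : nat -> R) (f : C -> C) : Prop :=
  exists a : nat -> C,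
    is_disk_expansion f a /\ ex_series (fun n => Cmod (a n) ^ 2 * beta n).

(* [is_H2_norm beta f N] says that f is in H^2(beta) and that its norm is N.
   As the expansion of f is unique, so is N. *)
Definition is_H2_norm (beta : nat -> R) (f : C -> C) (N : R) : Prop :=
  0 <= N /\
  exists a : nat -> C,
    is_disk_expansion f a /\
    is_series (fun n => Cmod (a n) ^ 2 * beta n) (N ^ 2).

Definition comp_op (phi : C -> C) (f : C -> C) : C -> C :=
  fun z => f (phi z).

(* Meant for phi analytic on the unit disk and mapping it into itself. *)
Definition bounded_comp_op (beta : nat -> R) (phi : C -> C) : Prop :=
  (forall f : C -> C, in_H2 beta f -> in_H2 beta (comp_op phi f)) /\
  (exists M : R, forall (f : C -> C) (N N' : R),
      is_H2_norm beta f N -> is_H2_norm beta (comp_op phi f) N' ->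
      N' <= M * N).

Definition T (a z : C) : C :=
  Cdiv (Cplus a z) (Cplus (RtoC 1) (Cmult (Cconj a) z)).

Definition slowly_oscillating (beta : nat -> R) : Prop :=
  exists c1 c2 : R, 0 < c1 < 1 /\ 1 < c2 /\
    forall m n : nat, INR n / 2 <= INR m <= 2 * INR n ->
      c1 <= beta m / beta n <= c2.

(* Main.v *)
(* Let A(m,n) be the coefficient of z^m in T_r^n, r = |a|.  Since a rotation
   reduces T_a to T_r, boundedness means that the real matrix (A(m,n)) is bounded
   on the weighted l^2 space.  Multiplication by T_r is an isometry of l^2, and
   the change of variables w = T_r(z) gives |m A(m,n)| = |n A(n,m)|.

   If beta is slowly oscillating, A is split into the part where m and n lie in
   comparable dyadic blocks, which is controlled by the boundedness of A on the
   unweighted l^2, and the rest, where A(m,n) decays exponentially.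

   Conversely, boundedness of the columns and of the rows of A gives, for all m
   and m', beta_m <= C beta_m' / (sum_j |A(m,j)| |A(j,m')|)^2.  For m' = m + 1 the
   sum is bounded below because <T_r^m, T_r^(m+1)> = r.  Hence neighbouring
   weights are comparable, so that |A(m,j)| may be replaced by
   |A(m,j)| + |A(m,j+1)|, and likewise for the other factor.  The numbers j A(j,m)
   satisfy a three-term recurrence in j which is oscillatory for j in an interval
   [s m, t m]; its energy is almost constant there and carries a fixed part of the
   mass, so that A(j,m)^2 + A(j+1,m)^2 >= c/m on that interval.  The sum is then
   bounded below as soon as m'/m is close to 1, and one concludes by chaining. *)
Require Import Defs.
From Stdlib Require Import Reals.
From Coquelicot Require Import Coquelicot.
From Stdlib Require Import Lra Lia Psatz.
From Stdlib Require ClassicalEpsilon Classical_Prop.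

Open Scope R_scope.


(** [coef r n m] is the entry A(m,n): the power comes first, the index of the coefficient second.
    Hardly any complex analysis is done on T_r. Multiplication by T_r is the recurrence [tau]; the
    isometry, the subordination principle and the Cauchy estimates appear as telescoping identities
    between partial sums, whose boundary term has a sign or tends to 0, and the symmetry comes from
    uniqueness for a two-index recurrence. The converse is shaped by the fact that single entries
    oscillate and may vanish, so that only two consecutive entries together can be bounded below.
    Trading an entry for a pair shifts the index of the weight; hence neighbouring weights must be
    compared beforehand, through the Gram matrix, which needs no pointwise information. A
    mean-square lower bound would not replace the energy argument: the mass of a row and that of a
    column could sit on disjoint sets of indices. *)

(* Coquelicot's generic lemmas leave equations in the carrier of a module, which
   [ring] and [field] do not recognize. *)
Ltac real_eq := match goal with |- @eq _ ?x ?y => change (@eq R x y) end.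

(** * Finite sums and series of real numbers *)

Lemma sum_n_SR (f : nat -> R) (n : nat) :
  sum_n f (S n) = sum_n f n + f (S n).
Proof. exact (sum_Sn f n). Qed.

Lemma sum_n_0R (f : nat -> R) : sum_n f 0 = f 0%nat.
Proof. exact (sum_O f). Qed.

Lemma sum_n_head (f : nat -> R) (n : nat) :
  sum_n f (S n) = f 0%nat + sum_n (fun k => f (S k)) n.
Proof.
  induction n as [|n IH]; [rewrite sum_n_SR, !sum_n_0R; reflexivity|].
  rewrite sum_n_SR, IH, sum_n_SR. apply Rplus_assoc.
Qed.

Lemma sum_n_scalR (c : R) (f : nat -> R) (n : nat) :
  sum_n (fun k => c * f k) n = c * sum_n f n.
Proof. exact (sum_n_mult_l c f n). Qed.

Lemma sum_n_plusR (f g : nat -> R) (n : nat) :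
  sum_n (fun k => f k + g k) n = sum_n f n + sum_n g n.
Proof. exact (sum_n_plus f g n). Qed.

Lemma sum_n_leR (f g : nat -> R) (n : nat) :
  (forall k, (k <= n)%nat -> f k <= g k) -> sum_n f n <= sum_n g n.
Proof.
  induction n as [|n IH]; intros H.
  - rewrite !sum_n_0R. apply H; lia.
  - rewrite !sum_n_SR. apply Rplus_le_compat; [apply IH; intros; apply H; lia | apply H; lia].
Qed.

Lemma sum_n_ge0 (f : nat -> R) (n : nat) :
  (forall k, (k <= n)%nat -> 0 <= f k) -> 0 <= sum_n f n.
Proof.
  intros H. induction n as [|n IH].
  - rewrite sum_n_0R. apply H; lia.
  - rewrite sum_n_SR. apply Rplus_le_le_0_compat; [apply IH; intros; apply H; lia | apply H; lia].
Qed.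

Lemma sum_n_ge_term (f : nat -> R) (n k : nat) :
  (forall j, 0 <= f j) -> (k <= n)%nat -> f k <= sum_n f n.
Proof.
  intros H. induction n as [|n IH]; intros Hk.
  - replace k with 0%nat by lia. rewrite sum_n_0R. lra.
  - rewrite sum_n_SR. destruct (Nat.eq_dec k (S n)) as [->|E].
    + assert (0 <= sum_n f n) by (apply sum_n_ge0; auto). lra.
    + assert (f k <= sum_n f n) by (apply IH; lia). specialize (H (S n)); lra.
Qed.

Lemma sum_n_monotone (f : nat -> R) (n m : nat) :
  (forall j, 0 <= f j) -> (n <= m)%nat -> sum_n f n <= sum_n f m.
Proof.
  intros H L. induction L as [|m L IH]; [lra|].
  rewrite sum_n_SR. specialize (H (S m)); lra.
Qed.

Lemma sum_n_CS (f g : nat -> R) (n : nat) :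
  sum_n (fun k => f k * g k) n ^ 2 <=
  sum_n (fun k => f k ^ 2) n * sum_n (fun k => g k ^ 2) n.
Proof.
  assert (key : forall a b c x y, 0 <= a -> 0 <= b -> c ^ 2 <= a * b ->
    (c + x * y) ^ 2 <= (a + x ^ 2) * (b + y ^ 2)).
  { intros a b c x y Ha Hb Hc.
    assert (2 * (c * (x * y)) <= a * y ^ 2 + b * x ^ 2).
    { destruct (Rle_or_lt (c * (x * y)) 0) as [H|H].
      - assert (0 <= a * y ^ 2) by (apply Rmult_le_pos; [lra|apply pow2_ge_0]).
        assert (0 <= b * x ^ 2) by (apply Rmult_le_pos; [lra|apply pow2_ge_0]). lra.
      - apply Rsqr_incr_0_var; unfold Rsqr.
        + assert (0 <= x ^ 2 * y ^ 2 * (a * b - c ^ 2)).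
          { apply Rmult_le_pos; [|lra]. apply Rmult_le_pos; apply pow2_ge_0. }
          assert (0 <= (a * y ^ 2 - b * x ^ 2) ^ 2) by apply pow2_ge_0. nra.
        + assert (0 <= a * y ^ 2) by (apply Rmult_le_pos; [lra|apply pow2_ge_0]).
          assert (0 <= b * x ^ 2) by (apply Rmult_le_pos; [lra|apply pow2_ge_0]). lra. }
    nra. }
  induction n as [|n IH].
  - rewrite !sum_n_0R. apply Req_le; ring.
  - rewrite !sum_n_SR. apply key; [| |exact IH];
      apply sum_n_ge0; intros; apply pow2_ge_0.
Qed.

Lemma is_series_lim_seq (a : nat -> R) (l : R) :
  is_series a l <-> is_lim_seq (sum_n a) l.
Proof. split; intros H; exact H. Qed.

Lemma is_series_eventually_0 (f : nat -> R) (N : nat) :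
  (forall n, (N < n)%nat -> f n = 0) -> is_series f (sum_n f N).
Proof.
  intros H. apply is_series_lim_seq.
  apply (is_lim_seq_ext_loc (fun _ => sum_n f N)); [|apply is_lim_seq_const].
  exists N. intros n Hn. induction Hn as [|n Hn IH]; [reflexivity|].
  rewrite sum_n_SR, <- IH, H by lia. symmetry. apply Rplus_0_r.
Qed.

Lemma is_series_sum_le (f : nat -> R) (l : R) (n : nat) :
  (forall k, 0 <= f k) -> is_series f l -> sum_n f n <= l.
Proof.
  intros H Hl.
  assert (Rbar_le (sum_n f n) l); [|exact H0].
  apply (is_lim_seq_le_loc (fun _ => sum_n f n) (sum_n f)).
  - exists n. intros m Hm. now apply sum_n_monotone.
  - apply is_lim_seq_const.
  - exact Hl.
Qed.

Lemma ex_series_bounded (f : nat -> R) (B : R) :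
  (forall k, 0 <= f k) -> (forall n, sum_n f n <= B) ->
  exists l : R, is_series f l /\ l <= B.
Proof.
  intros H HB.
  destruct (ex_finite_lim_seq_incr (sum_n f) B) as [l Hl].
  - intros n. rewrite sum_n_SR. specialize (H (S n)); lra.
  - exact HB.
  - exists l. split; [exact Hl|].
    assert (Rbar_le l B); [|exact H0].
    apply (is_lim_seq_le (sum_n f) (fun _ => B)); [exact HB|exact Hl|apply is_lim_seq_const].
Qed.

Lemma is_series_le (f g : nat -> R) (a b : R) :
  (forall k, f k <= g k) -> is_series f a -> is_series g b -> a <= b.
Proof.
  intros H Ha Hb.
  assert (Rbar_le a b); [|exact H0].
  apply (is_lim_seq_le (sum_n f) (sum_n g)); [|exact Ha|exact Hb].
  intros n. apply sum_n_leR. auto.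
Qed.

Lemma is_series_plusR (f g : nat -> R) (a b : R) :
  is_series f a -> is_series g b -> is_series (fun k => f k + g k) (a + b).
Proof. exact (is_series_plus f g a b). Qed.

Lemma is_series_scalR (c : R) (f : nat -> R) (a : R) :
  is_series f a -> is_series (fun k => c * f k) (c * a).
Proof. exact (is_series_scal_l c f a). Qed.

Lemma is_series_head (f : nat -> R) (a : R) :
  is_series f a <-> is_series (fun k => f (S k)) (a - f 0%nat).
Proof.
  split; intros H.
  - apply is_series_incr_1.
    change (is_series f (a - f 0%nat + f 0%nat)).
    replace (a - f 0%nat + f 0%nat) with a by ring. exact H.
  - apply is_series_decr_1. exact H.
Qed.

(** * The Taylor coefficients of the powers of a real disk automorphism *)

(* Multiplication by [(r + z) / (1 + r z)] on coefficient sequences. *)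
Fixpoint tau (r : R) (g : nat -> R) (m : nat) : R :=
  match m with
  | O => r * g O
  | S k => r * g (S k) + g k - r * tau r g k
  end.

Fixpoint coef (r : R) (n : nat) : nat -> R :=
  match n with
  | O => fun m => match m with O => 1 | S _ => 0 end
  | S n' => tau r (coef r n')
  end.

Lemma tau_S (r : R) (g : nat -> R) (m : nat) :
  tau r g (S m) = r * g (S m) + g m - r * tau r g m.
Proof. reflexivity. Qed.

Lemma tau_unique (r : R) (g h : nat -> R) :
  h 0%nat = r * g 0%nat ->
  (forall m, h (S m) = r * g (S m) + g m - r * h m) ->
  forall m, h m = tau r g m.
Proof.
  intros H0 HS m. induction m as [|m IH]; [exact H0|]. now rewrite HS, tau_S, IH.
Qed.

Lemma tau_ext (r : R) (f g : nat -> R) :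
  (forall m, f m = g m) -> forall m, tau r f m = tau r g m.
Proof.
  intros H m. induction m as [|m IH]; simpl; rewrite ?IH, !H; reflexivity.
Qed.

Lemma tau_lin (r a b : R) (f g : nat -> R) (m : nat) :
  tau r (fun k => a * f k + b * g k) m = a * tau r f m + b * tau r g m.
Proof.
  induction m as [|m IH]; simpl; [ring|]. rewrite IH. ring.
Qed.

(** Multiplication by z; in recurrences it also supplies the value 0 at the index -1. *)
Definition shift (g : nat -> R) (m : nat) : R :=
  match m with O => 0 | S k => g k end.

Lemma tau_shift (r : R) (g : nat -> R) (m : nat) :
  tau r (shift g) m = shift (tau r g) m.
Proof.
  induction m as [|m IH]; [simpl; ring|].
  rewrite tau_S, IH. destruct m; simpl; ring.
Qed.

Lemma coef_SS (r : R) (n m : nat) :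
  coef r (S n) (S m) = r * coef r n (S m) + coef r n m - r * coef r (S n) m.
Proof. reflexivity. Qed.

Lemma coef_col0 (r : R) (n : nat) : coef r n 0 = r ^ n.
Proof. induction n as [|n IH]; simpl; [reflexivity|]. now rewrite IH. Qed.

Lemma coef_1 (r : R) (m : nat) : coef r 1 (S m) = (1 - r ^ 2) * (- r) ^ m.
Proof.
  induction m as [|m IH]; [simpl; ring|].
  rewrite coef_SS, IH. simpl. ring.
Qed.

(* The coefficients of [T ^ n * (1 - r T) = (1 - r ^ 2) T ^ n / (1 + r z)]. *)
Definition coefU (r : R) (n m : nat) : R := coef r n m - r * coef r (S n) m.

Lemma coefU_tau (r : R) (n m : nat) : coefU r (S n) m = tau r (coefU r n) m.
Proof.
  unfold coefU. symmetry.
  rewrite (tau_ext r _ (fun k => 1 * coef r n k + (- r) * coef r (S n) k))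
    by (intros; ring).
  rewrite tau_lin. simpl. ring.
Qed.

Lemma coefU_step (r : R) (n m : nat) :
  coefU r n (S m) + r * coefU r n m = (1 - r ^ 2) * coef r n (S m).
Proof. unfold coefU. rewrite (coef_SS r n m). ring. Qed.

Lemma coefU_0 (r : R) (m : nat) : coefU r 0 m = (1 - r ^ 2) * (- r) ^ m.
Proof.
  unfold coefU. destruct m as [|m]; [simpl; ring|].
  rewrite coef_1. simpl. ring.
Qed.

Lemma coefU_col0 (r : R) (n : nat) : coefU r n 0 = (1 - r ^ 2) * r ^ n.
Proof. unfold coefU. rewrite !coef_col0. simpl. ring. Qed.

(** The two borders and this mixed difference determine a double array. Transposing with the sign
    (-1)^(n+m) is compatible with the mixed difference, so a symmetry needs to be checked only on
    the borders and on one identity. *)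
Lemma tau_rec_unique (r : R) (X Y : nat -> nat -> R) :
  (forall n, X n 0%nat = Y n 0%nat) -> (forall m, X 0%nat m = Y 0%nat m) ->
  (forall n m, X (S n) (S m) + r * X (S n) m - r * X n (S m) - X n m =
               Y (S n) (S m) + r * Y (S n) m - r * Y n (S m) - Y n m) ->
  forall n m, X n m = Y n m.
Proof.
  intros H0 H1 HS n. induction n as [|n IHn]; [exact H1|].
  induction m as [|m IHm]; [apply H0|].
  specialize (HS n m). rewrite !IHn, IHm in HS. lra.
Qed.

(** The generating function sum_n w^n T^n (1 - r T) equals (1 - r^2) / (1 + r z - r w - z w), which
    is invariant under (z, w) -> (-w, -z). *)
Lemma coefU_sym (r : R) (n m : nat) :
  coefU r n m = (-1) ^ (n + m) * coefU r m n.
Proof.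
  revert n m. apply (tau_rec_unique r).
  - intros n. rewrite coefU_col0, coefU_0, Nat.add_0_r.
    replace (- r) with (-1 * r) by ring. rewrite Rpow_mult_distr.
    replace ((-1) ^ n * ((1 - r ^ 2) * ((-1) ^ n * r ^ n)))
      with (((-1) * (-1)) ^ n * ((1 - r ^ 2) * r ^ n)) by (rewrite Rpow_mult_distr; ring).
    replace (-1 * -1) with 1 by ring. rewrite pow1. ring.
  - intros m. rewrite coefU_0, coefU_col0. simpl.
    replace (- r) with (-1 * r) by ring. rewrite Rpow_mult_distr. ring.
  - intros n m. rewrite (coefU_tau r n (S m)), tau_S, <- coefU_tau.
    replace (S n + S m)%nat with (S (S (n + m))) by lia.
    replace (S n + m)%nat with (S (n + m)) by lia.
    replace (n + S m)%nat with (S (n + m)) by lia.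
    rewrite (coefU_tau r m (S n)), tau_S, <- coefU_tau. simpl. ring.
Qed.

(* Both sides are coefficients of [z (T ^ n)'], computed once directly and once
   through the change of variables [w = T z] in the Cauchy integral. *)
Lemma coef_sym (r : R) (n m : nat) :
  INR m * coef r n m = (-1) ^ (n + m) * (INR n * coef r m n).
Proof.
  revert n m. apply (tau_rec_unique r).
  - intros n. destruct n; simpl; ring.
  - intros m. destruct m; simpl; ring.
  - intros n m.
    (* Multiplying by an index breaks the recurrence of [coef] by exactly this amount, whose
       symmetry is already known. *)
    transitivity (coefU r n m).
    + rewrite coef_SS, !S_INR. unfold coefU. ring.
    + replace (S n + S m)%nat with (S (S (n + m))) by lia.
      replace (S n + m)%nat with (S (n + m)) by lia.
      replace (n + S m)%nat with (S (n + m)) by lia.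
      rewrite coefU_sym. unfold coefU. rewrite (coef_SS r m n), !S_INR. simpl. ring.
Qed.

Lemma pow_m1_sq (k : nat) : (-1) ^ k * (-1) ^ k = 1.
Proof. rewrite <- Rpow_mult_distr. replace (-1 * -1) with 1 by ring. apply pow1. Qed.

Lemma coef_sym_abs (r : R) (n m : nat) :
  INR m * Rabs (coef r n m) = INR n * Rabs (coef r m n).
Proof.
  assert (H := f_equal Rabs (coef_sym r n m)).
  rewrite !Rabs_mult, pow_1_abs, !(Rabs_pos_eq (INR _)) in H by apply pos_INR. lra.
Qed.

(** With F = T^n this is (r + z) F' = n F (1 - r T). No derivative is formed: the symmetry turns
    both index factors on the left into n and leaves a value of [coefU r m n]. *)
Lemma coef_deriv (r : R) (n m : nat) :
  r * INR (S m) * coef r n (S m) + INR m * coef r n m = INR n * coefU r n m.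
Proof.
  replace (r * INR (S m) * coef r n (S m)) with (r * (INR (S m) * coef r n (S m))) by ring.
  rewrite (coef_sym r n (S m)), (coef_sym r n m), coefU_sym. unfold coefU.
  rewrite Nat.add_succ_r. simpl pow. ring.
Qed.

(* The three-term recurrence encodes the differential equation
   [(r + z) (1 + r z) F' = n (1 - r ^ 2) F] of [F = T ^ n]. *)
Lemma coef_three_term (r : R) (n m : nat) :
  r * (INR (S (S m)) * coef r n (S (S m))) + r * (INR m * coef r n m) =
  (INR n * (1 - r ^ 2) - INR (S m) * (1 + r ^ 2)) * coef r n (S m).
Proof.
  assert (H1 := coef_deriv r n (S m)). assert (H0 := coef_deriv r n m).
  assert (H2 := coefU_step r n m).
  assert (H3 : INR n * coefU r n (S m) + r * (INR n * coefU r n m) =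
    INR n * ((1 - r ^ 2) * coef r n (S m))) by (rewrite <- H2; ring).
  rewrite <- H1, <- H0 in H3. lra.
Qed.

(** The trace of |T| = 1 on the unit circle. With h = [tau r g], (h - r g)^2 - (g - r h)^2 = (1 -
    r^2) (h^2 - g^2), and the recurrence says that h - r g at m + 1 is g - r h at m; so the sum
    telescopes. *)
Lemma tau_energy (r : R) (g : nat -> R) (N : nat) :
  (1 - r ^ 2) * (sum_n (fun m => tau r g m ^ 2) N - sum_n (fun m => g m ^ 2) N) =
  - (g N - r * tau r g N) ^ 2.
Proof.
  induction N as [|N IH].
  - rewrite !sum_n_0R. simpl. ring.
  - rewrite !sum_n_SR.
    replace (g N - r * tau r g N) with (tau r g (S N) - r * g (S N)) in IH
      by (rewrite tau_S; ring).
    lra.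
Qed.

Lemma tau_contraction (r : R) (g : nat -> R) (N : nat) :
  0 <= r < 1 ->
  sum_n (fun m => tau r g m ^ 2) N <= sum_n (fun m => g m ^ 2) N.
Proof.
  intros Hr. assert (H := tau_energy r g N).
  assert (0 <= (g N - r * tau r g N) ^ 2) by apply pow2_ge_0.
  assert (0 < 1 - r ^ 2) by nra.
  apply Rminus_le, Rmult_le_reg_l with (1 - r ^ 2); [lra|]. rewrite H. lra.
Qed.

(** The contraction makes the image square summable; both sequences then tend to 0, and with them
    the boundary term of [tau_energy]. *)
Lemma tau_isometry (r : R) (g : nat -> R) (G : R) :
  0 <= r < 1 -> is_series (fun m => g m ^ 2) G ->
  is_series (fun m => tau r g m ^ 2) G.
Proof.
  intros Hr HG.
  destruct (ex_series_bounded (fun m => tau r g m ^ 2) G) as [H [HH _]].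
  - intros; apply pow2_ge_0.
  - intros N. eapply Rle_trans; [now apply tau_contraction|].
    apply is_series_sum_le; [intros; apply pow2_ge_0|exact HG].
  - assert (L : forall f F, is_series (fun m => f m ^ 2) F -> is_lim_seq f 0).
    { intros f F HF. apply is_lim_seq_abs_0.
      assert (K : is_lim_seq (fun m => f m ^ 2) 0) by (apply ex_series_lim_0; now exists F).
      apply (is_lim_seq_continuous sqrt _ 0) in K.
      - rewrite sqrt_0 in K. revert K. apply is_lim_seq_ext. intros n.
        replace (f n ^ 2) with (Rsqr (f n)) by (unfold Rsqr; ring). apply sqrt_Rsqr_abs.
      - apply continuity_pt_sqrt; lra. }
    assert (Lg := L _ _ HG). assert (Lh := L _ _ HH).
    assert (E : is_lim_seq (fun N => (1 - r ^ 2) *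
      (sum_n (fun m => tau r g m ^ 2) N - sum_n (fun m => g m ^ 2) N)) ((1 - r ^ 2) * (H - G))).
    { apply (is_lim_seq_scal_l _ (1 - r ^ 2) (H - G)).
      apply (is_lim_seq_minus' _ _ H G); [exact HH|exact HG]. }
    assert (E0 : is_lim_seq (fun N => - ((g N - r * tau r g N) * (g N - r * tau r g N)))
      (- ((0 - r * 0) * (0 - r * 0)))).
    { assert (is_lim_seq (fun N => g N - r * tau r g N) (0 - r * 0)).
      { apply is_lim_seq_minus'; [exact Lg|]. apply (is_lim_seq_scal_l _ r 0). exact Lh. }
      apply (is_lim_seq_opp _ ((0 - r * 0) * (0 - r * 0))).
      now apply is_lim_seq_mult'. }
    apply is_lim_seq_unique in E.
    rewrite (Lim_seq_ext _ (fun N => - ((g N - r * tau r g N) * (g N - r * tau r g N)))) in E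
      by (intros N; rewrite tau_energy; ring).
    apply is_lim_seq_unique in E0. rewrite E in E0. injection E0 as E1.
    assert (HG' : H = G); [|now rewrite <- HG'].
    assert (0 < 1 - r ^ 2) by nra.
    apply Rminus_diag_uniq, Rmult_eq_reg_l with (1 - r ^ 2); lra.
Qed.

Lemma coef_norm (r : R) (n : nat) :
  0 <= r < 1 -> is_series (fun m => coef r n m ^ 2) 1.
Proof.
  intros Hr. induction n as [|n IH]; [|now apply tau_isometry].
  apply is_series_head. simpl coef.
  replace (1 - 1 ^ 2) with (0 * / (1 - 0)) by field.
  apply (is_series_ext (fun k => 0 * 0 ^ k)); [intros; simpl; ring|].
  apply is_series_scalR, is_series_geom. rewrite Rabs_R0; lra.
Qed.

Lemma coef_sum_le (r : R) (n N : nat) :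
  0 <= r < 1 -> sum_n (fun m => coef r n m ^ 2) N <= 1.
Proof.
  intros Hr. apply is_series_sum_le; [intros; apply pow2_ge_0|]. now apply coef_norm.
Qed.

Lemma coef_le1 (r : R) (n m : nat) : 0 <= r < 1 -> Rabs (coef r n m) <= 1.
Proof.
  intros Hr.
  assert (H : coef r n m ^ 2 <= 1).
  { eapply Rle_trans; [|apply (coef_sum_le r n m Hr)].
    apply (sum_n_ge_term (fun m => coef r n m ^ 2)); [intros; apply pow2_ge_0|lia]. }
  apply Rabs_le. nra.
Qed.

Lemma coefU_norm (r : R) (n : nat) :
  0 <= r < 1 -> is_series (fun m => coefU r n m ^ 2) (1 - r ^ 2).
Proof.
  intros Hr. induction n as [|n IH].
  - apply (is_series_ext (fun m => (1 - r ^ 2) ^ 2 * (r ^ 2) ^ m)).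
    { intros m. rewrite coefU_0, Rpow_mult_distr, <- !pow_mult.
      rewrite (Nat.mul_comm m 2), !pow_mult. replace ((- r) ^ 2) with (r ^ 2) by ring. reflexivity. }
    replace (1 - r ^ 2) with ((1 - r ^ 2) ^ 2 * / (1 - r ^ 2)) at 1 by (field; nra).
    apply is_series_scalR, is_series_geom. rewrite Rabs_pos_eq; nra.
  - apply (is_series_ext (fun m => tau r (coefU r n) m ^ 2)).
    { intros m. now rewrite coefU_tau. }
    now apply tau_isometry.
Qed.

(** Polarization: T^n - r T^(n+1) has squared norm 1 - r^2, so 1 - r^2 = 1 + r^2 - 2 r <T^n,
    T^(n+1)>. *)
Lemma coef_gram (r : R) (n : nat) :
  0 < r < 1 -> is_series (fun m => coef r n m * coef r (S n) m) r.
Proof.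
  intros Hr.
  assert (H0 : 0 <= r < 1) by lra.
  assert (K := is_series_plusR _ _ _ _
    (is_series_plusR _ _ _ _ (coef_norm r n H0)
      (is_series_scalR (r ^ 2) _ _ (coef_norm r (S n) H0)))
    (is_series_scalR (-1) _ _ (coefU_norm r n H0))).
  apply (is_series_scalR (/ (2 * r))) in K.
  replace (/ (2 * r) * (1 + r ^ 2 * 1 + -1 * (1 - r ^ 2))) with r in K by (field; lra).
  revert K. apply is_series_ext. intros m. unfold coefU. real_eq. field. lra.
Qed.

(** * Exponential decay off the diagonal and boundedness on unweighted l^2 *)

Lemma pow_anti (q : R) (m n : nat) :
  0 <= q <= 1 -> (m <= n)%nat -> q ^ n <= q ^ m.
Proof.
  intros Hq L. induction L as [|n L IH]; [lra|].
  assert (0 <= q ^ n) by (apply pow_le; lra). simpl. nra.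
Qed.

(* The image of the disk of radius [rho] under [T] is contained in the disk of
   radius [s], which on quadratic forms is a positivity certificate. *)
Lemma tau_scaled_contraction (r rho : R) (g : nat -> R) (N : nat) :
  0 <= r < 1 -> 0 < rho < 1 ->
  sum_n (fun m => (rho ^ m * tau r g m) ^ 2) N <=
  ((r + rho) / (1 + r * rho)) ^ 2 * sum_n (fun m => (rho ^ m * g m) ^ 2) N.
Proof.
  intros Hr Hrho. set (s := (r + rho) / (1 + r * rho)).
  assert (Hd : 0 < 1 + r * rho) by nra.
  assert (Hs : 0 < s) by (apply Rdiv_lt_0_compat; lra).
  (* In [form] below, the coefficients of h^2 and h x force [c] and [d]; that of x^2 then agrees
     because s = T(rho). Along h_m = rho^m [tau r g m] and x_m = rho^m g_m the left side of [form]
     telescopes. *)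
  set (c := (1 - rho ^ 2 * r ^ 2) - r * (1 - rho ^ 2) / s).
  set (d := r * (1 - rho ^ 2) / s).
  assert (Hd' : 0 <= d).
  { apply Rmult_le_pos; [apply Rmult_le_pos; nra|]. left; now apply Rinv_0_lt_compat. }
  assert (Hc : 0 < c).
  { replace c with (rho * (1 - r ^ 2) / s).
    - apply Rdiv_lt_0_compat; [apply Rmult_lt_0_compat; nra|lra].
    - unfold c, s. field. lra. }
  assert (form : forall h x, (h - r * x) ^ 2 - rho ^ 2 * (x - r * h) ^ 2 =
    c * (h ^ 2 - s ^ 2 * x ^ 2) + d * (h - s * x) ^ 2).
  { intros h x. unfold c, d, s. field. lra. }
  assert (K : c * (sum_n (fun m => (rho ^ m * tau r g m) ^ 2) N -
      s ^ 2 * sum_n (fun m => (rho ^ m * g m) ^ 2) N) <=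
      - rho ^ 2 * (rho ^ N * (g N - r * tau r g N)) ^ 2).
  { induction N as [|N IH].
    - rewrite !sum_n_0R. simpl tau. simpl (rho ^ 0).
      assert (F := form (1 * (r * g 0%nat)) (1 * g 0%nat)).
      assert (0 <= d * (1 * (r * g 0%nat) - s * (1 * g 0%nat)) ^ 2)
        by (apply Rmult_le_pos; [lra|apply pow2_ge_0]).
      lra.
    - rewrite !sum_n_SR.
      assert (F := form (rho ^ S N * tau r g (S N)) (rho ^ S N * g (S N))).
      assert (P : 0 <= d * (rho ^ S N * tau r g (S N) - s * (rho ^ S N * g (S N))) ^ 2)
        by (apply Rmult_le_pos; [lra|apply pow2_ge_0]).
      replace (rho ^ S N * tau r g (S N) - r * (rho ^ S N * g (S N)))
        with (rho * (rho ^ N * (g N - r * tau r g N))) in F by (rewrite tau_S; simpl; ring).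
      replace ((rho * (rho ^ N * (g N - r * tau r g N))) ^ 2) with
        (rho ^ 2 * (rho ^ N * (g N - r * tau r g N)) ^ 2) in F by ring.
      replace (rho ^ S N * g (S N) - r * (rho ^ S N * tau r g (S N))) with
        (rho ^ S N * (g (S N) - r * tau r g (S N))) in F by ring.
      lra. }
  assert (0 <= rho ^ 2 * (rho ^ N * (g N - r * tau r g N)) ^ 2)
    by (apply Rmult_le_pos; apply pow2_ge_0).
  nra.
Qed.

(** A Cauchy estimate on the circle of radius rho, where |T| <= T(rho), obtained by applying the
    scaled contraction n times to the constant 1. *)
Lemma coef_scaled_bound (r rho : R) (n m : nat) :
  0 <= r < 1 -> 0 < rho < 1 ->
  rho ^ m * Rabs (coef r n m) <= ((r + rho) / (1 + r * rho)) ^ n.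
Proof.
  intros Hr Hrho. set (s := (r + rho) / (1 + r * rho)).
  assert (Hs : 0 < s) by (apply Rdiv_lt_0_compat; nra).
  assert (K : forall N, sum_n (fun k => (rho ^ k * coef r n k) ^ 2) N <= (s ^ n) ^ 2).
  { induction n as [|n IH]; intros N.
    - eapply Rle_trans; [|apply Req_le; instantiate (1 := 1); simpl; ring].
      induction N as [|N IH]; [rewrite sum_n_0R; simpl; lra|].
      rewrite sum_n_SR. change (coef r 0 (S N)) with 0.
      replace ((rho ^ S N * 0) ^ 2) with 0 by ring. lra.
    - eapply Rle_trans; [apply (tau_scaled_contraction r rho (coef r n) N Hr Hrho)|].
      fold s. replace ((s ^ S n) ^ 2) with (s ^ 2 * (s ^ n) ^ 2) by (simpl; ring).
      apply Rmult_le_compat_l; [apply pow2_ge_0|apply IH]. }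
  assert (H : (rho ^ m * coef r n m) ^ 2 <= (s ^ n) ^ 2).
  { eapply Rle_trans; [|apply (K m)].
    apply (sum_n_ge_term (fun k => (rho ^ k * coef r n k) ^ 2)); [intros; apply pow2_ge_0|lia]. }
  rewrite <- (Rabs_pos_eq (rho ^ m)) by (apply pow_le; lra).
  rewrite <- Rabs_mult.
  assert (0 <= s ^ n) by (apply pow_le; lra).
  apply Rabs_le. nra.
Qed.

(** At rho = 1/2 the entry is at most 2^m s^n. With s = q^2 and 2 q^kappa <= 1, one factor q^n
    absorbs 2^m as soon as n >= kappa m. The opposite range follows by symmetry, since there the
    factor n / m is at most 1. *)
Lemma coef_decay (r : R) :
  0 <= r < 1 ->
  exists (q : R) (kappa : nat), 0 < q < 1 /\ (0 < kappa)%nat /\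
    forall n m,
      ((kappa * m <= n)%nat -> Rabs (coef r n m) <= q ^ n) /\
      ((kappa * n <= m)%nat -> Rabs (coef r n m) <= q ^ m).
Proof.
  intros Hr. set (s := (r + / 2) / (1 + r * / 2)).
  assert (Hs : 0 < s < 1).
  { unfold s. split; [apply Rdiv_lt_0_compat; lra|].
    apply Rmult_lt_reg_r with (1 + r * / 2); [lra|].
    unfold Rdiv. rewrite Rmult_assoc, Rinv_l; lra. }
  set (q := sqrt s).
  assert (Hqq : q * q = s) by (apply sqrt_sqrt; lra).
  assert (Hq : 0 < q < 1).
  { split; [apply sqrt_lt_R0; lra|]. rewrite <- sqrt_1. apply sqrt_lt_1; lra. }
  destruct (pow_lt_1_zero q ltac:(rewrite Rabs_pos_eq; lra) (/ 2) ltac:(lra)) as [k0 Hk0].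
  set (kappa := S k0).
  assert (Hk : 2 * q ^ kappa <= 1).
  { assert (H := Hk0 kappa ltac:(unfold kappa; lia)).
    rewrite Rabs_pos_eq in H by (apply pow_le; lra). lra. }
  assert (A1 : forall n m, (kappa * m <= n)%nat -> Rabs (coef r n m) <= q ^ n).
  { intros n m Hnm.
    assert (B := coef_scaled_bound r (/ 2) n m Hr ltac:(lra)). fold s in B.
    rewrite pow_inv in B.
    assert (P2 : 0 < 2 ^ m) by (apply pow_lt; lra).
    assert (Rabs (coef r n m) <= 2 ^ m * s ^ n).
    { apply Rmult_le_reg_l with (/ 2 ^ m); [now apply Rinv_0_lt_compat|].
      rewrite <- Rmult_assoc, Rinv_l by lra. lra. }
    eapply Rle_trans; [exact H|].
    rewrite <- Hqq, Rpow_mult_distr.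
    rewrite <- (Rmult_1_l (q ^ n)) at 3. rewrite <- Rmult_assoc.
    apply Rmult_le_compat_r; [apply pow_le; lra|].
    replace n with (kappa * m + (n - kappa * m))%nat by lia.
    rewrite pow_add, pow_mult, <- Rmult_assoc, <- Rpow_mult_distr.
    rewrite <- (Rmult_1_r 1). apply Rmult_le_compat.
    - apply pow_le. assert (0 < q ^ kappa) by (apply pow_lt; lra). lra.
    - apply pow_le; lra.
    - rewrite <- (pow1 m). apply pow_incr.
      assert (0 < q ^ kappa) by (apply pow_lt; lra). lra.
    - rewrite <- (pow1 (n - kappa * m)). apply pow_incr. lra. }
  exists q, kappa. split; [exact Hq|]. split; [unfold kappa; lia|].
  intros n m. split; [apply A1|].
  intros Hnm. destruct n as [|n].
  - destruct m as [|m]; simpl coef.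
    + rewrite Rabs_R1. simpl; lra.
    + rewrite Rabs_R0. apply pow_le; lra.
  - assert (B := A1 m (S n) Hnm). assert (E := coef_sym_abs r (S n) m).
    assert (Hle : (S n <= m)%nat) by (unfold kappa in *; nia).
    apply le_INR in Hle. assert (0 < INR (S n)) by (apply lt_0_INR; lia).
    assert (0 <= Rabs (coef r m (S n))) by apply Rabs_pos.
    assert (0 <= Rabs (coef r (S n) m)) by apply Rabs_pos.
    apply Rle_trans with (Rabs (coef r m (S n))); [|exact B].
    apply Rmult_le_reg_l with (INR m); [lra|]. rewrite E.
    apply Rmult_le_compat_r; lra.
Qed.

(** Boundedness in terms of squared norms, for finitely supported vectors and a truncated image, so
    that no convergence is involved. Real vectors suffice because the matrix is real. *)
Definition fin_bounded (r : R) (beta : nat -> R) (M : R) : Prop :=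
  forall (x : nat -> R) (N N' : nat),
    sum_n (fun m => beta m * sum_n (fun n => coef r n m * x n) N ^ 2) N' <=
    M * sum_n (fun n => beta n * x n ^ 2) N.

(* Littlewood subordination, along Horner's scheme: the quantity
   [|F|^2 + F(0)^2] grows by at most [L x_0^2] from [G] to [F = x_0 + T G]. *)
Lemma coef_l2_bounded (r : R) :
  0 <= r < 1 -> fin_bounded r (fun _ => 1) (2 + 4 * r ^ 2 / (1 - r ^ 2)).
Proof.
  intros Hr x N N'. set (L := 2 + 4 * r ^ 2 / (1 - r ^ 2)).
  assert (Hd : 0 < 1 - r ^ 2) by nra.
  assert (HL : forall a w, 2 * (a + r * w) ^ 2 <= (1 + r ^ 2) * w ^ 2 + L * a ^ 2).
  { intros a w.
    (* [L] is the value for which the discriminant of this quadratic form in w and a vanishes. *)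
    assert (E : (1 + r ^ 2) * w ^ 2 + L * a ^ 2 - 2 * (a + r * w) ^ 2 =
      ((1 - r ^ 2) * w - 2 * r * a) ^ 2 / (1 - r ^ 2)) by (unfold L; field; lra).
    assert (0 <= ((1 - r ^ 2) * w - 2 * r * a) ^ 2 / (1 - r ^ 2)).
    { apply Rmult_le_pos; [apply pow2_ge_0|]. left; now apply Rinv_0_lt_compat. }
    lra. }
  assert (hor : forall N x m, sum_n (fun n => coef r n m * x n) (S N) =
    x 0%nat * coef r 0 m + tau r (fun k => sum_n (fun n => coef r n k * x (S n)) N) m).
  { clear x N. intros N. induction N as [|N IH]; intros x m.
    - rewrite sum_n_SR, sum_n_0R.
      rewrite (tau_ext r _ (fun k => x 1%nat * coef r 0 k + 0 * coef r 0 k)).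
      + rewrite tau_lin. change (tau r (coef r 0)) with (coef r 1). real_eq. ring.
      + intros k. rewrite sum_n_0R. real_eq. ring.
    - rewrite sum_n_SR, IH.
      rewrite (tau_ext r (fun k => sum_n (fun n => coef r n k * x (S n)) (S N))
        (fun k => 1 * sum_n (fun n => coef r n k * x (S n)) N + x (S (S N)) * coef r (S N) k)).
      + rewrite tau_lin. change (tau r (coef r (S N))) with (coef r (S (S N))). real_eq. ring.
      + intros k. rewrite sum_n_SR. real_eq. ring. }
  enough (Phi : sum_n (fun m => sum_n (fun n => coef r n m * x n) N ^ 2) N' +
      sum_n (fun n => coef r n 0 * x n) N ^ 2 <= L * sum_n (fun n => x n ^ 2) N).
  { rewrite (sum_n_ext (fun m => 1 * _) (fun m => sum_n (fun n => coef r n m * x n) N ^ 2))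
      by (intros; real_eq; ring).
    rewrite (sum_n_ext (fun n => 1 * _) (fun n => x n ^ 2)) by (intros; real_eq; ring).
    assert (0 <= sum_n (fun n => coef r n 0 * x n) N ^ 2) by apply pow2_ge_0. lra. }
  assert (Hsplit : forall f c, sum_n (fun m => (c * coef r 0 m + f m) ^ 2) N' =
    sum_n (fun m => f m ^ 2) N' - f 0%nat ^ 2 + (c + f 0%nat) ^ 2).
  { intros f c. induction N' as [|k IH].
    - rewrite !sum_n_0R. simpl coef. real_eq. ring.
    - rewrite !sum_n_SR, IH. simpl coef. real_eq. ring. }
  revert x. induction N as [|N IH]; intros x.
  - rewrite !sum_n_0R.
    rewrite (sum_n_ext _ (fun m => (x 0%nat * coef r 0 m + 0) ^ 2))
      by (intros; rewrite sum_n_0R; real_eq; ring).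
    rewrite (Hsplit (fun _ => 0)).
    assert (sum_n (fun _ => 0 ^ 2) N' = 0).
    { rewrite sum_n_const. real_eq. ring. }
    rewrite H. specialize (HL (x 0%nat) 0). simpl coef. lra.
  - set (G := fun k => sum_n (fun n => coef r n k * x (S n)) N).
    rewrite (sum_n_ext _ (fun m => (x 0%nat * coef r 0 m + tau r G m) ^ 2))
      by (intros; now rewrite hor).
    rewrite Hsplit, hor. fold G.
    change (tau r G 0) with (r * G 0%nat). simpl (coef r 0 0).
    assert (T := tau_contraction r G N' Hr).
    assert (I := IH (fun n => x (S n))). fold G in I.
    replace (sum_n (fun n => coef r n 0 * x (S n)) N) with (G 0%nat) in I by reflexivity.
    rewrite (sum_n_head (fun n => x n ^ 2)). specialize (HL (x 0%nat) (G 0%nat)).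
    assert (I' : sum_n (fun m => G m ^ 2) N' + G 0%nat ^ 2 <=
      L * sum_n (fun n => x (S n) ^ 2) N) by exact I.
    lra.
Qed.

(** * The composition operator in coefficients *)

Lemma sum_n_Re (a : nat -> C) (N : nat) :
  Re (sum_n (G := C_AbelianMonoid) a N) = sum_n (fun n => Re (a n)) N.
Proof.
  induction N as [|N IH]; [now rewrite !sum_O|].
  rewrite sum_n_SR, sum_Sn. rewrite <- IH. apply re_plus.
Qed.

Lemma sum_n_Im (a : nat -> C) (N : nat) :
  Im (sum_n (G := C_AbelianMonoid) a N) = sum_n (fun n => Im (a n)) N.
Proof.
  induction N as [|N IH]; [now rewrite !sum_O|].
  rewrite sum_n_SR, sum_Sn. rewrite <- IH. reflexivity.
Qed.

Definition is_Cseries (a : nat -> C) (l : C) : Prop :=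
  @is_series C_AbsRing C_NormedModule a l.

Lemma is_Cseries_parts (a : nat -> C) (l : C) :
  is_Cseries a l <->
  is_series (fun n => Re (a n)) (Re l) /\ is_series (fun n => Im (a n)) (Im l).
Proof.
  unfold is_Cseries, is_series. split.
  - intros H. split.
    + apply (filterlim_ext (fun N => Re (sum_n (G := C_AbelianMonoid) a N)));
        [intros; apply sum_n_Re|].
      apply filterlim_locally. intros eps.
      generalize (proj1 (filterlim_locally (U := C_UniformSpace) _ l) H eps).
      apply filter_imp. intros N [B _]. exact B.
    + apply (filterlim_ext (fun N => Im (sum_n (G := C_AbelianMonoid) a N)));
        [intros; apply sum_n_Im|].
      apply filterlim_locally. intros eps.
      generalize (proj1 (filterlim_locally (U := C_UniformSpace) _ l) H eps).
      apply filter_imp. intros N [_ B]. exact B.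
  - intros [H1 H2]. apply (filterlim_locally (U := C_UniformSpace) _ l). intros eps.
    generalize (filter_and _ _
      (proj1 (filterlim_locally (U := R_UniformSpace) _ (Re l)) H1 eps)
      (proj1 (filterlim_locally (U := R_UniformSpace) _ (Im l)) H2 eps)).
    apply filter_imp. intros N [B1 B2].
    rewrite <- sum_n_Re in B1. rewrite <- sum_n_Im in B2. split; assumption.
Qed.

Lemma is_Cseries_ext (a b : nat -> C) (l : C) :
  (forall n, a n = b n) -> is_Cseries a l -> is_Cseries b l.
Proof. apply is_series_ext. Qed.

Lemma is_Cseries_scal (c : C) (a : nat -> C) (l : C) :
  is_Cseries a l -> is_Cseries (fun n => c * a n)%C (c * l)%C.
Proof. exact (is_series_scal_l (K := C_AbsRing) (V := C_NormedModule) c a l). Qed.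

Lemma C_eq_parts (x y : C) : Re x = Re y -> Im x = Im y -> x = y.
Proof. destruct x, y; simpl; intros; subst; reflexivity. Qed.

Lemma is_Cseries_unique (a : nat -> C) (l l' : C) :
  is_Cseries a l -> is_Cseries a l' -> l = l'.
Proof.
  rewrite !is_Cseries_parts. intros [H1 H2] [H3 H4].
  apply C_eq_parts.
  - rewrite <- (is_series_unique _ _ H1). now rewrite <- (is_series_unique _ _ H3).
  - rewrite <- (is_series_unique _ _ H2). now rewrite <- (is_series_unique _ _ H4).
Qed.

Lemma pow_n_C (z : C) (k : nat) : pow_n (K := C_AbsRing) z k = (z ^ k)%C.
Proof. induction k as [|k IH]; [reflexivity|]. simpl. now rewrite IH. Qed.

Lemma is_disk_expansion_iff (f : C -> C) (a : nat -> C) :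
  is_disk_expansion f a <->
  forall z, unit_disk z -> is_Cseries (fun n => a n * z ^ n)%C (f z).
Proof.
  unfold is_disk_expansion, is_pseries.
  assert (E : forall (z c : C) n, (c * z ^ n)%C = (pow_n (K := C_AbsRing) z n * c)%C).
  { intros z c n. rewrite (pow_n_C z n). apply Cmult_comm. }
  split; intros H z Hz; specialize (H z Hz); revert H; apply is_Cseries_ext;
    intros n; [symmetry|]; apply E.
Qed.

Lemma im_le_Cmod (c : C) : Rabs (Im c) <= Cmod c.
Proof. eapply Rle_trans; [apply Rmax_r|apply (Rmax_Cmod c)]. Qed.

Lemma Cmod_le_parts (c : C) : Cmod c <= Rabs (Re c) + Rabs (Im c).
Proof.
  assert (H := Cmod2_alt c). assert (0 <= Cmod c) by apply Cmod_ge_0.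
  assert (0 <= Rabs (Re c)) by apply Rabs_pos. assert (0 <= Rabs (Im c)) by apply Rabs_pos.
  rewrite <- (pow2_abs (Re c)), <- (pow2_abs (Im c)) in H. nra.
Qed.

Lemma disk_expansion_real (f : C -> C) (a : nat -> C) (x : R) :
  is_disk_expansion f a -> Rabs x < 1 ->
  is_series (fun n => Re (a n) * x ^ n) (Re (f (RtoC x))) /\
  is_series (fun n => Im (a n) * x ^ n) (Im (f (RtoC x))).
Proof.
  intros H Hx. rewrite is_disk_expansion_iff in H.
  assert (U : unit_disk (RtoC x)) by (unfold unit_disk; now rewrite Cmod_R).
  destruct (proj1 (is_Cseries_parts _ _) (H _ U)) as [H1 H2].
  split; [revert H1|revert H2]; apply is_series_ext; intros n;
    rewrite <- RtoC_pow; [apply re_scal_r|apply im_scal_r].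
Qed.

Lemma CV_radius_ge (a : nat -> R) (x : R) :
  0 <= x -> ex_series (fun n => a n * x ^ n) -> Rbar_le x (CV_radius a).
Proof.
  intros Hx H. destruct (Rbar_le_lt_dec x (CV_radius a)) as [|L]; [assumption|exfalso].
  apply (CV_disk_outside a x); [rewrite Rabs_pos_eq; assumption|].
  now apply ex_series_lim_0.
Qed.

Lemma ex_series_dom (f g : nat -> R) :
  (forall n, Rabs (f n) <= g n) -> ex_series g -> ex_series f.
Proof. exact (@ex_series_le R_AbsRing R_CompleteNormedModule f g). Qed.

Lemma disk_expansion_abs (f : C -> C) (a : nat -> C) (s : R) :
  is_disk_expansion f a -> 0 <= s < 1 ->
  ex_series (fun n => Cmod (a n) * s ^ n).
Proof.
  intros H Hs. set (t := (1 + s) / 2).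
  assert (Ht : Rabs t < 1) by (unfold t; rewrite Rabs_pos_eq; lra).
  destruct (disk_expansion_real f a t H Ht) as [H1 H2].
  assert (D : forall c : nat -> R, ex_series (fun n => c n * t ^ n) ->
    ex_series (fun n => Rabs (c n * s ^ n))).
  { intros c Hc. apply CV_disk_inside. apply Rbar_lt_le_trans with t.
    - simpl. rewrite Rabs_pos_eq; unfold t; lra.
    - apply CV_radius_ge; [unfold t; lra|exact Hc]. }
  apply (ex_series_dom _ (fun n => Rabs (Re (a n) * s ^ n) + Rabs (Im (a n) * s ^ n))).
  - intros n. assert (0 <= s ^ n) by (apply pow_le; lra).
    rewrite !Rabs_mult, (Rabs_pos_eq (s ^ n)), (Rabs_pos_eq (Cmod _)) by
      (assumption || apply Cmod_ge_0).
    rewrite <- Rmult_plus_distr_r. apply Rmult_le_compat_r; [assumption|apply Cmod_le_parts].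
  - apply (@ex_series_plus R_AbsRing R_NormedModule); apply D; [eexists; exact H1|eexists; exact H2].
Qed.

Lemma disk_expansion_unique (f : C -> C) (a b : nat -> C) (n : nat) :
  is_disk_expansion f a -> is_disk_expansion f b -> a n = b n.
Proof.
  intros Ha Hb.
  assert (U : forall u v : nat -> R, (forall x, Rabs x < 1 ->
    exists l, is_series (fun k => u k * x ^ k) l /\ is_series (fun k => v k * x ^ k) l) -> u n = v n).
  { intros u v H.
    destruct (H (/ 2)) as [l [H1 H2]]; [rewrite Rabs_pos_eq; lra|].
    apply PSeries_ext_recip.
    - apply Rbar_lt_le_trans with (/ 2); [simpl; lra|].
      apply CV_radius_ge; [lra|eexists; exact H1].
    - apply Rbar_lt_le_trans with (/ 2); [simpl; lra|].
      apply CV_radius_ge; [lra|eexists; exact H2].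
    - exists (mkposreal 1 Rlt_0_1). intros x Hx.
      destruct (H x) as [l' [H3 H4]].
      + replace x with (x - 0) by ring. exact Hx.
      + unfold PSeries. rewrite (is_series_unique _ _ H3). symmetry. now apply is_series_unique. }
  apply C_eq_parts.
  - apply (U (fun n => Re (a n)) (fun n => Re (b n))). intros x Hx.
    exists (Re (f (RtoC x))). split; now apply disk_expansion_real.
  - apply (U (fun n => Im (a n)) (fun n => Im (b n))). intros x Hx.
    exists (Im (f (RtoC x))). split; now apply disk_expansion_real.
Qed.

Lemma is_series_finite_sum (c : nat -> nat -> R) (b : nat -> R) (M : nat) :
  (forall m, is_series (fun n => c n m) (b m)) ->
  is_series (fun n => sum_n (c n) M) (sum_n b M).
Proof.
  intros H. induction M as [|M IH].
  - rewrite sum_n_0R. apply (is_series_ext (fun n => c n 0%nat)); [|apply H].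
    intros n. symmetry. apply sum_n_0R.
  - rewrite sum_n_SR. apply (is_series_ext (fun n => sum_n (c n) M + c n (S M))).
    + intros n. symmetry. apply sum_n_SR.
    + now apply is_series_plusR.
Qed.

(** Fubini under a product bound. If t M is the tail of q, then cutting the inner series at M costs
    at most p n * t M, and after summation over n at most P * t M, which tends to 0. *)
Lemma series_switch (c : nat -> nat -> R) (p q cs b : nat -> R) (l : R) :
  (forall n, 0 <= p n) -> (forall m, 0 <= q m) -> ex_series p -> ex_series q ->
  (forall n m, Rabs (c n m) <= p n * q m) ->
  (forall n, is_series (c n) (cs n)) -> is_series cs l ->
  (forall m, is_series (fun n => c n m) (b m)) ->
  is_series b l.
Proof.
  intros Hp Hq [P HP] [Q HQ] Hc Hcs Hl Hb.
  set (t := fun M => Q - sum_n q M).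
  assert (T : forall n M, Rabs (cs n - sum_n (c n) M) <= p n * t M).
  { intros n M.
    assert (L : Rbar_le (Rabs (cs n - sum_n (c n) M)) (p n * t M)); [|exact L].
    apply (is_lim_seq_le_loc (fun K => Rabs (sum_n (c n) K - sum_n (c n) M))
      (fun K => p n * (sum_n q K - sum_n q M))).
    - exists M. intros K HK. induction HK as [|K HK IH].
      + rewrite !Rminus_diag, Rabs_R0. lra.
      + rewrite !sum_n_SR.
        replace (sum_n (c n) K + c n (S K) - sum_n (c n) M) with
          ((sum_n (c n) K - sum_n (c n) M) + c n (S K)) by ring.
        eapply Rle_trans; [apply Rabs_triang|]. specialize (Hc n (S K)). lra.
    - apply (is_lim_seq_abs _ (cs n - sum_n (c n) M)).
      apply is_lim_seq_minus'; [apply Hcs|apply is_lim_seq_const].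
    - apply (is_lim_seq_scal_l _ (p n) (t M)).
      apply is_lim_seq_minus'; [exact HQ|apply is_lim_seq_const]. }
  assert (B : forall M, Rabs (sum_n b M - l) <= P * t M).
  { intros M. assert (S1 := is_series_finite_sum c b M Hb).
    assert (S2 := is_series_plusR _ _ _ _ S1 (is_series_scalR (-1) _ _ Hl)).
    assert (S3 := is_series_scalR (t M) _ _ HP).
    apply Rabs_le. split.
    - apply Ropp_le_cancel. rewrite Ropp_involutive.
      apply (is_series_le (fun n => -1 * (sum_n (c n) M + -1 * cs n)) (fun n => t M * p n)).
      + intros n. specialize (T n M). apply Rabs_le_between in T. lra.
      + replace (- (sum_n b M - l)) with (-1 * (sum_n b M + -1 * l)) by ring.
        now apply is_series_scalR.
      + replace (P * t M) with (t M * P) by ring. exact S3.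
    - apply (is_series_le (fun n => sum_n (c n) M + -1 * cs n) (fun n => t M * p n)).
      + intros n. specialize (T n M). apply Rabs_le_between in T. lra.
      + replace (sum_n b M - l) with (sum_n b M + -1 * l) by ring. exact S2.
      + replace (P * t M) with (t M * P) by ring. exact S3. }
  assert (Lt : is_lim_seq (fun M => P * t M) 0).
  { replace 0 with (P * (Q - Q)) by ring. apply (is_lim_seq_scal_l _ P (Q - Q)).
    apply is_lim_seq_minus'; [apply is_lim_seq_const|exact HQ]. }
  assert (L0 : is_lim_seq (fun M => sum_n b M - l) 0).
  { apply is_lim_seq_abs_0.
    apply (is_lim_seq_le_le (fun _ => 0) _ (fun M => P * t M)); [|apply is_lim_seq_const|exact Lt].
    intros M. split; [apply Rabs_pos|apply B]. }
  assert (L1 : is_lim_seq (fun M => (sum_n b M - l) + l) (0 + l))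
    by (apply is_lim_seq_plus'; [exact L0|apply is_lim_seq_const]).
  rewrite Rplus_0_l in L1. revert L1. apply is_lim_seq_ext. intros M.
  unfold Rminus. rewrite Rplus_assoc, Rplus_opp_l. apply Rplus_0_r.
Qed.

Lemma is_lim_seq_Cmod_0 (u : nat -> C) :
  is_lim_seq (fun n => Cmod (u n)) 0 ->
  is_lim_seq (fun n => Re (u n)) 0 /\ is_lim_seq (fun n => Im (u n)) 0.
Proof.
  intros H. split; apply is_lim_seq_abs_0;
    apply (is_lim_seq_le_le (fun _ => 0) _ (fun n => Cmod (u n)));
    try apply is_lim_seq_const; try exact H; intros n; split; try apply Rabs_pos;
    [apply re_le_Cmod|apply im_le_Cmod].
Qed.

Lemma one_plus_neq0 (w : C) : Cmod w < 1 -> (1 + w)%C <> 0.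
Proof.
  intros H E. assert (w = - (1))%C.
  { replace w with ((1 + w) - 1)%C by ring. rewrite E. ring. }
  rewrite H0, Cmod_opp, Cmod_1 in H. lra.
Qed.

Lemma unit_disk_mult_R (r : R) (z : C) :
  0 <= r < 1 -> unit_disk z -> Cmod (r * z) < 1.
Proof.
  unfold unit_disk. intros Hr Hz. rewrite Cmod_mult, Cmod_R, Rabs_pos_eq by lra.
  assert (0 <= Cmod z) by apply Cmod_ge_0. nra.
Qed.

Definition C_conv (u : nat -> C) (l : C) : Prop :=
  is_lim_seq (fun n => Re (u n)) (Re l) /\ is_lim_seq (fun n => Im (u n)) (Im l).

Lemma C_conv_mult (c : C) (u : nat -> C) (l : C) :
  C_conv u l -> C_conv (fun n => c * u n)%C (c * l)%C.
Proof.
  intros [H1 H2]. split.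
  - rewrite re_mult.
    apply (is_lim_seq_ext (fun n => Re c * Re (u n) - Im c * Im (u n)));
      [intros; now rewrite re_mult|].
    apply is_lim_seq_minus';
      [apply (is_lim_seq_scal_l _ (Re c) (Re l))|apply (is_lim_seq_scal_l _ (Im c) (Im l))];
      assumption.
  - rewrite im_mult.
    apply (is_lim_seq_ext (fun n => Re c * Im (u n) + Im c * Re (u n)));
      [intros; now rewrite im_mult|].
    apply is_lim_seq_plus';
      [apply (is_lim_seq_scal_l _ (Re c) (Im l))|apply (is_lim_seq_scal_l _ (Im c) (Re l))];
      assumption.
Qed.

Lemma C_conv_minus (u v : nat -> C) (l l' : C) :
  C_conv u l -> C_conv v l' -> C_conv (fun n => u n - v n)%C (l - l')%C.
Proof.
  intros [H1 H2] [H3 H4]. split; [exact (is_lim_seq_minus' _ _ _ _ H1 H3)|exact (is_lim_seq_minus' _ _ _ _ H2 H4)].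
Qed.

Lemma C_conv_ext (u v : nat -> C) (l : C) :
  (forall n, u n = v n) -> C_conv u l -> C_conv v l.
Proof.
  intros H [H1 H2]. split; [revert H1|revert H2]; apply is_lim_seq_ext; intros; now rewrite H.
Qed.

Lemma is_Cseries_conv (a : nat -> C) (l : C) :
  is_Cseries a l <-> C_conv (sum_n (G := C_AbelianMonoid) a) l.
Proof.
  rewrite is_Cseries_parts, !is_series_lim_seq. unfold C_conv. split; intros [H1 H2]; split;
    [revert H1|revert H2|revert H1|revert H2]; apply is_lim_seq_ext; intros n;
    (apply sum_n_Re || apply sum_n_Im || (symmetry; apply sum_n_Re) || (symmetry; apply sum_n_Im)).
Qed.

(** By induction on n: the partial sums satisfy (1 + r z) H_N = (r + z) G_N - z e_N, with a boundary
    term e_N that tends to 0 because the coefficients are bounded by 1 and |z| < 1. *)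
Lemma coef_gen_series (r : R) (n : nat) (z : C) :
  0 <= r < 1 -> unit_disk z ->
  is_Cseries (fun m => coef r n m * z ^ m)%C (((r + z) / (1 + r * z)) ^ n)%C.
Proof.
  intros Hr Hz.
  assert (D : (1 + r * z)%C <> 0) by (apply one_plus_neq0, unit_disk_mult_R; assumption).
  induction n as [|n IH].
  - apply is_Cseries_conv.
    apply (C_conv_ext (fun _ => 1%C)); [|split; apply is_lim_seq_const].
    intros N. induction N as [|N IH].
    + rewrite sum_O. simpl. ring.
    + rewrite sum_Sn. rewrite <- IH.
      change (RtoC 1 = 1 + RtoC 0 * z ^ S N)%C. ring.
  - apply is_Cseries_conv. apply is_Cseries_conv in IH.
    set (G := sum_n (G := C_AbelianMonoid) (fun m => coef r n m * z ^ m)%C) in *.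
    set (H := sum_n (G := C_AbelianMonoid) (fun m => coef r (S n) m * z ^ m)%C).
    set (e := fun N => (z ^ N * (coef r n N - r * coef r (S n) N))%C).
    assert (E : forall N, ((1 + r * z) * H N = (r + z) * G N - z * e N)%C).
    { intros N. unfold H, G, e. induction N as [|N IHN].
      - rewrite !sum_O. change (coef r (S n) 0) with (r * coef r n 0%nat).
        rewrite RtoC_mult. simpl. ring.
      - rewrite !sum_Sn.
        change (plus (G := C_AbelianMonoid)) with Cplus.
        rewrite Cmult_plus_distr_l, IHN, (coef_SS r n N), RtoC_minus, RtoC_plus, !RtoC_mult.
        change (coef r (S n)) with (tau r (coef r n)).
        rewrite !Cpow_S. ring. }
    assert (e0 : C_conv e 0).
    { apply is_lim_seq_Cmod_0.
      apply (is_lim_seq_le_le (fun _ => 0) _ (fun N => 2 * Cmod z ^ N)).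
      - intros N. split; [apply Cmod_ge_0|]. unfold e.
        rewrite Cmod_mult, Cmod_pow, Rmult_comm.
        apply Rmult_le_compat_r; [apply pow_le, Cmod_ge_0|].
        rewrite <- RtoC_mult, <- RtoC_minus, Cmod_R.
        assert (A := coef_le1 r n N Hr). assert (B := coef_le1 r (S n) N Hr).
        apply Rabs_le_between in A. apply Rabs_le_between in B. apply Rabs_le. nra.
      - apply is_lim_seq_const.
      - replace 0 with (2 * 0) by ring. apply (is_lim_seq_scal_l _ 2 0).
        apply is_lim_seq_geom. rewrite Rabs_pos_eq; [exact Hz|apply Cmod_ge_0]. }
    assert (K := C_conv_mult (/ (1 + r * z)) _ _
      (C_conv_minus _ _ _ _ (C_conv_mult (r + z) _ _ IH) (C_conv_mult z _ _ e0))).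
    replace (/ (1 + r * z) * ((r + z) * ((r + z) / (1 + r * z)) ^ n - z * 0))%C
      with (((r + z) / (1 + r * z)) ^ S n)%C in K.
    + revert K. apply C_conv_ext. intros N. rewrite <- E. field. exact D.
    + rewrite Cpow_S. field. exact D.
Qed.

Lemma T_real_in_disk (r : R) (z : C) :
  0 <= r < 1 -> unit_disk z -> unit_disk ((r + z) / (1 + r * z))%C.
Proof.
  intros Hr Hz.
  assert (D : (1 + r * z)%C <> 0) by (apply one_plus_neq0, unit_disk_mult_R; assumption).
  unfold unit_disk in *. rewrite Cmod_div by exact D.
  assert (P : 0 < Cmod (1 + r * z)) by now apply Cmod_gt_0.
  apply Rmult_lt_reg_r with (Cmod (1 + r * z)); [exact P|].
  unfold Rdiv. rewrite Rmult_assoc, Rinv_l, Rmult_1_r, Rmult_1_l by lra.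
  assert (A := Cmod2_alt (1 + r * z)). assert (B := Cmod2_alt (r + z)).
  assert (Z := Cmod2_alt z). assert (0 <= Cmod z) by apply Cmod_ge_0.
  assert (0 <= Cmod (r + z)) by apply Cmod_ge_0.
  rewrite !re_plus, !im_plus, ?re_scal_l, ?im_scal_l, ?re_RtoC, ?im_RtoC in *.
  (* This product equals |1 + r z|^2 - |r + z|^2. *)
  assert (0 < (1 - r ^ 2) * (1 - (Re z ^ 2 + Im z ^ 2))).
  { apply Rmult_lt_0_compat; nra. }
  nra.
Qed.

Lemma exists_rotation (a : C) :
  exists u : C, Cmod u = 1 /\ a = (Cmod a * u)%C.
Proof.
  destruct (Req_dec (Cmod a) 0) as [E|E].
  - exists 1%C. split; [apply Cmod_1|]. rewrite E. apply Cmod_eq_0 in E. rewrite E. ring.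
  - assert (E' : RtoC (Cmod a) <> 0) by (intros H; apply RtoC_inj in H; auto).
    exists (a / Cmod a)%C. split; [|field; exact E'].
    rewrite Cmod_div, Cmod_R, Rabs_pos_eq by (exact E' || apply Cmod_ge_0). now field.
Qed.

Lemma Cmod1_conj (u : C) : Cmod u = 1 -> (u * Cconj u)%C = 1.
Proof. intros H. rewrite <- Cmod2_conj, H. f_equal. ring. Qed.

Lemma T_rotation (u : C) (r : R) (z : C) :
  Cmod u = 1 ->
  T (r * u) z = (u * ((r + Cconj u * z) / (1 + r * (Cconj u * z))))%C.
Proof.
  intros Hu.
  unfold T. rewrite Cmult_conj.
  replace (Cconj r) with (RtoC r) by (unfold Cconj, RtoC; simpl; f_equal; ring).
  assert (H : (u * (r + Cconj u * z))%C = (r * u + z)%C).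
  { replace (u * (r + Cconj u * z))%C with (r * u + (u * Cconj u) * z)%C by ring.
    rewrite (Cmod1_conj u Hu). ring. }
  rewrite <- H, <- (Cmult_assoc r). unfold Cdiv. symmetry. apply Cmult_assoc.
Qed.

(** The real matrix acts on the rotated coefficients a_n u^n and gives b; the second rotation is
    kept apart, as it does not change moduli. The identity is an exchange of summations in sum_n a_n
    u^n T_r(w)^n, with w = [Cconj u * z]. *)
Lemma comp_op_expansion (u : C) (r : R) (f : C -> C) (a : nat -> C) :
  0 <= r < 1 -> Cmod u = 1 -> is_disk_expansion f a ->
  exists b : nat -> C,
    (forall m, is_Cseries (fun n => a n * u ^ n * coef r n m)%C (b m)) /\
    is_disk_expansion (comp_op (T (r * u)) f) (fun m => b m * Cconj u ^ m)%C.
Proof.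
  intros Hr Hu Ha.
  assert (Hun : forall n, Cmod (u ^ n) = 1) by (intros; rewrite Cmod_pow, Hu; apply pow1).
  assert (Hs : forall rho, 0 < rho < 1 -> 0 < (r + rho) / (1 + r * rho) < 1).
  { intros rho Hrho. split; [apply Rdiv_lt_0_compat; nra|].
    apply Rmult_lt_reg_r with (1 + r * rho); [nra|].
    unfold Rdiv. rewrite Rmult_assoc, Rinv_l; nra. }
  assert (Hb : forall m, exists l, is_Cseries (fun n => a n * u ^ n * coef r n m)%C l).
  { intros m. specialize (Hs (/ 2) ltac:(lra)).
    assert (B := coef_scaled_bound r (/ 2)). set (s := (r + / 2) / (1 + r * / 2)) in *.
    assert (E : ex_series (fun n => 2 ^ m * (Cmod (a n) * s ^ n))).
    { apply (ex_series_scal_l (K := R_AbsRing) (V := R_NormedModule) (2 ^ m)).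
      apply (disk_expansion_abs f); [exact Ha|lra]. }
    assert (P : forall n, Cmod (a n * u ^ n * coef r n m) <= 2 ^ m * (Cmod (a n) * s ^ n)).
    { intros n. rewrite !Cmod_mult, Hun, Cmod_R, Rmult_1_r.
      specialize (B n m Hr ltac:(lra)). rewrite pow_inv in B.
      assert (0 < 2 ^ m) by (apply pow_lt; lra).
      assert (Rabs (coef r n m) <= 2 ^ m * s ^ n).
      { apply Rmult_le_reg_l with (/ 2 ^ m); [now apply Rinv_0_lt_compat|].
        rewrite <- Rmult_assoc, Rinv_l by lra. lra. }
      replace (2 ^ m * (Cmod (a n) * s ^ n)) with (Cmod (a n) * (2 ^ m * s ^ n)) by ring.
      apply Rmult_le_compat_l; [apply Cmod_ge_0|assumption]. }
    destruct (ex_series_dom (fun n => Re (a n * u ^ n * coef r n m)%C) _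
      (fun n => Rle_trans _ _ _ (re_le_Cmod _) (P n)) E) as [l1 H1].
    destruct (ex_series_dom (fun n => Im (a n * u ^ n * coef r n m)%C) _
      (fun n => Rle_trans _ _ _ (im_le_Cmod _) (P n)) E) as [l2 H2].
    exists (l1, l2). apply is_Cseries_parts. split; assumption. }
  apply ClassicalEpsilon.choice in Hb. destruct Hb as [b Hb].
  exists b. split; [exact Hb|].
  apply is_disk_expansion_iff. intros z Hz.
  set (w := (Cconj u * z)%C).
  assert (Hw : unit_disk w).
  { unfold w, unit_disk. now rewrite Cmod_mult, Cmod_conj, Hu, Rmult_1_l. }
  set (W := ((r + w) / (1 + r * w))%C).
  assert (HW : unit_disk (u * W)%C).
  { unfold unit_disk. rewrite Cmod_mult, Hu, Rmult_1_l. now apply T_real_in_disk. }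
  unfold comp_op. rewrite (T_rotation u r z Hu). fold w W.
  assert (F := proj1 (is_disk_expansion_iff f a) Ha _ HW).
  (* A radius strictly between |w| and 1: then |w| / rho < 1 makes [q] summable, and s < 1 makes [p]
     summable by the absolute convergence of the expansion of f. *)
  set (rho := (1 + Cmod w) / 2).
  assert (Hw0 : 0 <= Cmod w) by apply Cmod_ge_0.
  assert (Hrho : 0 < rho < 1) by (unfold rho, unit_disk in *; lra).
  specialize (Hs rho Hrho). set (s := (r + rho) / (1 + r * rho)) in *.
  set (p := fun n => Cmod (a n) * s ^ n). set (q := fun m => (Cmod w / rho) ^ m).
  assert (Hp : forall n, 0 <= p n).
  { intros n. apply Rmult_le_pos; [apply Cmod_ge_0|apply pow_le; lra]. }
  assert (Hwr : 0 <= Cmod w / rho < 1).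
  { split; [apply Rmult_le_pos; [lra|left; apply Rinv_0_lt_compat; lra]|].
    apply Rmult_lt_reg_r with rho; [lra|]. unfold Rdiv.
    rewrite Rmult_assoc, Rinv_l by lra. unfold rho, unit_disk in *; lra. }
  assert (Hq : forall m, 0 <= q m) by (intros; apply pow_le; lra).
  assert (Ep : ex_series p) by (apply (disk_expansion_abs f); [exact Ha|lra]).
  assert (Eq : ex_series q).
  { eexists. apply is_series_geom. rewrite Rabs_pos_eq; lra. }
  set (c := fun n m => (a n * u ^ n * (coef r n m * w ^ m))%C).
  assert (Hc : forall n m, Cmod (c n m) <= p n * q m).
  { intros n m. unfold c, p, q. rewrite !Cmod_mult, Hun, Cmod_R, Cmod_pow, Rmult_1_r.
    assert (B := coef_scaled_bound r rho n m Hr Hrho). fold s in B.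
    assert (0 < rho ^ m) by (apply pow_lt; lra).
    rewrite Rmult_assoc. apply Rmult_le_compat_l; [apply Cmod_ge_0|].
    unfold Rdiv. rewrite Rpow_mult_distr, pow_inv.
    replace (s ^ n * (Cmod w ^ m * / rho ^ m)) with (/ rho ^ m * s ^ n * Cmod w ^ m) by ring.
    apply Rmult_le_compat_r; [now apply pow_le|].
    apply Rmult_le_reg_l with (rho ^ m); [assumption|].
    rewrite <- Rmult_assoc, Rinv_r by lra. lra. }
  assert (S1 : forall n, is_Cseries (c n) (a n * (u * W) ^ n)%C).
  { intros n. rewrite Cpow_mult_l, Cmult_assoc. apply is_Cseries_scal.
    now apply coef_gen_series. }
  assert (S2 : forall m, is_Cseries (fun n => c n m) (b m * w ^ m)%C).
  { intros m. rewrite Cmult_comm.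
    apply (is_Cseries_ext (fun n => w ^ m * (a n * u ^ n * coef r n m))%C).
    - intros n. unfold c. ring.
    - apply is_Cseries_scal, Hb. }
  assert (G : is_Cseries (fun m => b m * w ^ m)%C (f (u * W)%C)).
  { apply is_Cseries_parts. apply is_Cseries_parts in F. destruct F as [F1 F2]. split.
    - apply (series_switch (fun n m => Re (c n m)) p q (fun n => Re (a n * (u * W) ^ n)%C));
        try assumption.
      + intros n m. eapply Rle_trans; [apply re_le_Cmod|apply Hc].
      + intros n. apply (proj1 (is_Cseries_parts _ _) (S1 n)).
      + intros m. apply (proj1 (is_Cseries_parts _ _) (S2 m)).
    - apply (series_switch (fun n m => Im (c n m)) p q (fun n => Im (a n * (u * W) ^ n)%C));
        try assumption.
      + intros n m. eapply Rle_trans; [apply im_le_Cmod|apply Hc].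
      + intros n. apply (proj1 (is_Cseries_parts _ _) (S1 n)).
      + intros m. apply (proj1 (is_Cseries_parts _ _) (S2 m)). }
  revert G. apply is_Cseries_ext. intros m. unfold w. rewrite Cpow_mult_l. ring.
Qed.

Lemma Cmod2_nonneg (c : C) (b : R) : 0 < b -> 0 <= Cmod c ^ 2 * b.
Proof. intros; apply Rmult_le_pos; [apply pow2_ge_0|lra]. Qed.

Lemma fin_bounded_limit (r : R) (beta : nat -> R) (M : R) (x y : nat -> R) (X : R) (N' : nat) :
  0 <= M -> (forall n, 0 < beta n) -> fin_bounded r beta M ->
  is_series (fun n => beta n * x n ^ 2) X ->
  (forall m, is_series (fun n => coef r n m * x n) (y m)) ->
  sum_n (fun m => beta m * y m ^ 2) N' <= M * X.
Proof.
  intros HM Hb HF HX Hy.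
  assert (L : Rbar_le (sum_n (fun m => beta m * y m ^ 2) N') (M * X)); [|exact L].
  apply (is_lim_seq_le
    (fun N => sum_n (fun m => beta m * sum_n (fun n => coef r n m * x n) N ^ 2) N')
    (fun _ => M * X)).
  - intros N. eapply Rle_trans; [apply HF|]. apply Rmult_le_compat_l; [exact HM|].
    apply is_series_sum_le; [|exact HX].
    intros k. apply Rmult_le_pos; [left; apply Hb|apply pow2_ge_0].
  - induction N' as [|N' IH].
    + rewrite sum_n_0R.
      apply (is_lim_seq_ext (fun N => beta 0%nat *
        (sum_n (fun n => coef r n 0 * x n) N * sum_n (fun n => coef r n 0 * x n) N))).
      { intros N. rewrite sum_n_0R. real_eq. ring. }
      apply (is_lim_seq_scal_l _ (beta 0%nat) (y 0%nat ^ 2)).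
      replace (y 0%nat ^ 2) with (y 0%nat * y 0%nat) by ring.
      apply is_lim_seq_mult'; apply (Hy 0%nat).
    + rewrite sum_n_SR.
      apply (is_lim_seq_ext (fun N =>
        sum_n (fun m => beta m * sum_n (fun n => coef r n m * x n) N ^ 2) N' +
        beta (S N') * (sum_n (fun n => coef r n (S N') * x n) N *
          sum_n (fun n => coef r n (S N') * x n) N))).
      { intros N. rewrite sum_n_SR. f_equal. real_eq. ring. }
      apply is_lim_seq_plus'; [exact IH|].
      apply (is_lim_seq_scal_l _ (beta (S N')) (y (S N') ^ 2)).
      replace (y (S N') ^ 2) with (y (S N') * y (S N')) by ring.
      apply is_lim_seq_mult'; apply (Hy (S N')).
  - apply is_lim_seq_const.
Qed.

Lemma pow_Cmod1 (u : C) (n : nat) : Cmod u = 1 -> Cmod (u ^ n) = 1.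
Proof. intros H. rewrite Cmod_pow, H. apply pow1. Qed.

Lemma fin_bounded_comp_op (beta : nat -> R) (a : C) (M : R) :
  (forall n, 0 < beta n) -> unit_disk a -> fin_bounded (Cmod a) beta M ->
  bounded_comp_op beta (T a).
Proof.
  intros Hb Ha HF0.
  assert (HF : fin_bounded (Cmod a) beta (Rabs M)).
  { intros x N N'. eapply Rle_trans; [apply HF0|]. apply Rmult_le_compat_r; [|apply Rle_abs].
    apply sum_n_ge0. intros k _. apply Rmult_le_pos; [left; apply Hb|apply pow2_ge_0]. }
  clear HF0. assert (HM : 0 <= Rabs M) by apply Rabs_pos. revert HM HF.
  generalize (Rabs M). clear M. intros M HM HF.
  destruct (exists_rotation a) as [u [Hu Ea]].
  set (r := Cmod a) in *.
  assert (Hr : 0 <= r < 1) by (split; [apply Cmod_ge_0|exact Ha]).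
  assert (key : forall f c N2, is_disk_expansion f c ->
    is_series (fun n => Cmod (c n) ^ 2 * beta n) N2 ->
    exists b, is_disk_expansion (comp_op (T a) f) b /\
      forall N', sum_n (fun m => Cmod (b m) ^ 2 * beta m) N' <= M * N2).
  { intros f c N2 Hf HN.
    destruct (comp_op_expansion u r f c Hr Hu Hf) as [b [Hb1 Hb2]].
    exists (fun m => b m * Cconj u ^ m)%C. split; [rewrite Ea; exact Hb2|].
    intros N'.
    (* The real matrix acts separately on the real and imaginary parts, and squared norms add up. *)
    set (x := fun n => Re (c n * u ^ n)%C). set (y := fun n => Im (c n * u ^ n)%C).
    assert (Exy : forall n, Cmod (c n) ^ 2 * beta n = beta n * x n ^ 2 + beta n * y n ^ 2).
    { intros n. unfold x, y.
      rewrite <- (Rmult_1_r (Cmod (c n))), <- (pow_Cmod1 u n Hu), <- Cmod_mult, Cmod2_alt. ring. }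
    assert (D : forall w : nat -> R, (forall n, beta n * w n ^ 2 <= Cmod (c n) ^ 2 * beta n) ->
      exists W, is_series (fun n => beta n * w n ^ 2) W).
    { intros w Hw. destruct (ex_series_bounded (fun n => beta n * w n ^ 2) N2) as [W [HW _]].
      - intros; apply Rmult_le_pos; [left; apply Hb|apply pow2_ge_0].
      - intros k. eapply Rle_trans; [|apply (is_series_sum_le _ _ k) with (2 := HN)].
        + apply sum_n_leR. intros; apply Hw.
        + intros; now apply Cmod2_nonneg.
      - now exists W. }
    assert (Px : forall n, 0 <= beta n * x n ^ 2)
      by (intros; apply Rmult_le_pos; [left; apply Hb|apply pow2_ge_0]).
    assert (Py : forall n, 0 <= beta n * y n ^ 2)
      by (intros; apply Rmult_le_pos; [left; apply Hb|apply pow2_ge_0]).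
    destruct (D x) as [X HX]; [intros n; rewrite Exy; specialize (Py n); lra|].
    destruct (D y) as [Y HY]; [intros n; rewrite Exy; specialize (Px n); lra|].
    assert (EN : X + Y = N2).
    { rewrite <- (is_series_unique _ _ (is_series_plusR _ _ _ _ HX HY)).
      rewrite <- (is_series_unique _ _ HN). apply Series_ext. intros n. now rewrite Exy. }
    assert (B1 := fin_bounded_limit r beta M x (fun m => Re (b m)) X N' HM Hb HF HX).
    assert (B2 := fin_bounded_limit r beta M y (fun m => Im (b m)) Y N' HM Hb HF HY).
    assert (Hb1' := fun m => proj1 (is_Cseries_parts _ _) (Hb1 m)).
    specialize (B1 (fun m => is_series_ext _ _ _
      (fun n => eq_trans (re_scal_r _ _) (Rmult_comm _ _)) (proj1 (Hb1' m)))).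
    specialize (B2 (fun m => is_series_ext _ _ _
      (fun n => eq_trans (im_scal_r _ _) (Rmult_comm _ _)) (proj2 (Hb1' m)))).
    rewrite <- EN, Rmult_plus_distr_l.
    eapply Rle_trans; [|exact (Rplus_le_compat _ _ _ _ B1 B2)].
    rewrite <- sum_n_plusR. apply sum_n_leR. intros k _.
    rewrite Cmod_mult, pow_Cmod1, Rmult_1_r by now rewrite Cmod_conj.
    rewrite Cmod2_alt. apply Req_le; ring. }
  split.
  - intros f [c [Hc [N2 HN]]]. destruct (key f c N2 Hc HN) as [b [Hb1 Hb2]].
    exists b. split; [exact Hb1|].
    destruct (ex_series_bounded (fun m => Cmod (b m) ^ 2 * beta m) (M * N2)) as [l [Hl _]].
    + intros; now apply Cmod2_nonneg.
    + exact Hb2.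
    + now exists l.
  (* [fin_bounded] compares squared norms, hence the square root. *)
  - exists (sqrt M). intros f N N' [HN [c [Hc HcN]]] [HN' [b' [Hb' HbN']]].
    destruct (key f c _ Hc HcN) as [b [Hb1 Hb2]].
    assert (K : N' ^ 2 <= M * N ^ 2).
    { destruct (ex_series_bounded (fun m => Cmod (b m) ^ 2 * beta m) (M * N ^ 2)) as [l [Hl Hl']].
      - intros; now apply Cmod2_nonneg.
      - exact Hb2.
      - replace (N' ^ 2) with l; [exact Hl'|].
        rewrite <- (is_series_unique _ _ Hl), <- (is_series_unique _ _ HbN').
        apply Series_ext. intros n. now rewrite (disk_expansion_unique _ _ _ n Hb1 Hb'). }
    apply Rsqr_incr_0_var; [|apply Rmult_le_pos; [apply sqrt_pos|exact HN]].
    unfold Rsqr. replace (sqrt M * N * (sqrt M * N)) with (sqrt M * sqrt M * N ^ 2) by ring.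
    rewrite sqrt_sqrt by exact HM. lra.
Qed.

Lemma is_Cseries_eventually_0 (f : nat -> C) (N : nat) :
  (forall n, (N < n)%nat -> f n = 0) -> is_Cseries f (sum_n (G := C_AbelianMonoid) f N).
Proof.
  intros H. apply is_Cseries_parts. rewrite sum_n_Re, sum_n_Im.
  split; apply is_series_eventually_0; intros n Hn; now rewrite H.
Qed.

Lemma comp_op_fin_bounded (beta : nat -> R) (a : C) :
  (forall n, 0 < beta n) -> unit_disk a -> bounded_comp_op beta (T a) ->
  exists M, 0 < M /\ fin_bounded (Cmod a) beta M.
Proof.
  intros Hb Ha [HB1 [M HM]].
  destruct (exists_rotation a) as [u [Hu Ea]].
  set (r := Cmod a) in *.
  assert (Hr : 0 <= r < 1) by (split; [apply Cmod_ge_0|exact Ha]).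
  (* The summand 1 makes the constant positive, as the row estimate requires. *)
  exists (M ^ 2 + 1). split; [assert (0 <= M ^ 2) by apply pow2_ge_0; lra|].
  intros x N N'.
  (* The test function is a polynomial; the factor [Cconj u ^ n] cancels the rotation [u ^ n] of
     [comp_op_expansion], so that the matrix acts on the real vector x itself. *)
  set (c := fun n => if Nat.leb n N then (x n * Cconj u ^ n)%C else RtoC 0).
  set (f := fun z => sum_n (G := C_AbelianMonoid) (fun n => c n * z ^ n)%C N).
  assert (c0 : forall n, (N < n)%nat -> c n = 0).
  { intros n Hn. unfold c. now rewrite (proj2 (Nat.leb_gt n N) Hn). }
  assert (c1 : forall n, (n <= N)%nat -> c n = (x n * Cconj u ^ n)%C).
  { intros n Hn. unfold c. now rewrite (proj2 (Nat.leb_le n N) Hn). }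
  assert (Hf : is_disk_expansion f c).
  { apply is_disk_expansion_iff. intros z _. apply is_Cseries_eventually_0.
    intros n Hn. rewrite c0 by exact Hn. ring. }
  set (N2 := sum_n (fun n => beta n * x n ^ 2) N).
  assert (HN2 : 0 <= N2).
  { apply sum_n_ge0. intros; apply Rmult_le_pos; [left; apply Hb|apply pow2_ge_0]. }
  assert (S2 : is_series (fun n => Cmod (c n) ^ 2 * beta n) N2).
  { replace N2 with (sum_n (fun n => Cmod (c n) ^ 2 * beta n) N).
    - apply is_series_eventually_0. intros n Hn. rewrite c0, Cmod_0 by exact Hn. ring.
    - apply sum_n_ext_loc. intros n Hn. rewrite c1 by exact Hn.
      rewrite Cmod_mult, pow_Cmod1, Rmult_1_r by now rewrite Cmod_conj.
      rewrite Cmod_R, pow2_abs. real_eq. ring. }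
  assert (Hin : in_H2 beta f) by (exists c; split; [exact Hf|now exists N2]).
  destruct (HB1 f Hin) as [b' [Hb' [l Hl]]].
  assert (Hl0 : 0 <= l).
  { eapply Rle_trans; [|apply (is_series_sum_le _ _ 0) with (2 := Hl)].
    - rewrite sum_n_0R. now apply Cmod2_nonneg.
    - intros; now apply Cmod2_nonneg. }
  assert (K : sqrt l <= M * sqrt N2).
  { apply (HM f).
    - split; [apply sqrt_pos|]. exists c. split; [exact Hf|].
      simpl. rewrite Rmult_1_r, sqrt_sqrt by exact HN2. exact S2.
    - split; [apply sqrt_pos|]. exists b'. split; [exact Hb'|].
      simpl. rewrite Rmult_1_r, sqrt_sqrt by exact Hl0. exact Hl. }
  assert (K2 : l <= M ^ 2 * N2).
  { rewrite <- (sqrt_sqrt l Hl0), <- (sqrt_sqrt N2 HN2).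
    replace (M ^ 2 * (sqrt N2 * sqrt N2)) with ((M * sqrt N2) * (M * sqrt N2)) by ring.
    apply Rmult_le_compat; try apply sqrt_pos; exact K. }
  destruct (comp_op_expansion u r f c Hr Hu Hf) as [b [Hb1 Hb2]].
  rewrite <- Ea in Hb2.
  assert (E : forall m, Cmod (b' m) ^ 2 = sum_n (fun n => coef r n m * x n) N ^ 2).
  { intros m. rewrite (disk_expansion_unique _ _ _ m Hb' Hb2).
    rewrite Cmod_mult, pow_Cmod1, Rmult_1_r by now rewrite Cmod_conj.
    replace (b m) with (RtoC (sum_n (fun n => coef r n m * x n) N)).
    { now rewrite Cmod_R, pow2_abs. }
    apply (is_Cseries_unique (fun n => c n * u ^ n * coef r n m)%C); [|apply Hb1].
    apply (is_Cseries_ext (fun n => RtoC (if Nat.leb n N then coef r n m * x n else 0))).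
    - intros n. unfold c. destruct (Nat.leb n N); [|ring].
      replace (x n * Cconj u ^ n * u ^ n * coef r n m)%C with
        (x n * coef r n m * (u * Cconj u) ^ n)%C by (rewrite Cpow_mult_l; ring).
      rewrite (Cmod1_conj u Hu), Cpow_1_l, RtoC_mult. ring.
    - apply is_Cseries_parts. split.
      + rewrite re_RtoC.
        replace (sum_n (fun n => coef r n m * x n) N) with
          (sum_n (fun n => if Nat.leb n N then coef r n m * x n else 0) N).
        * apply is_series_eventually_0. intros n Hn. now rewrite (proj2 (Nat.leb_gt n N) Hn).
        * apply sum_n_ext_loc. intros n Hn. now rewrite (proj2 (Nat.leb_le n N) Hn).
      + rewrite im_RtoC. assert (Z := is_series_eventually_0 (fun _ => 0) 0 (fun _ _ => eq_refl)).
        rewrite sum_n_0R in Z. exact Z. }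
  rewrite (sum_n_ext _ (fun m => Cmod (b' m) ^ 2 * beta m))
    by (intros m; rewrite E; apply Rmult_comm).
  eapply Rle_trans; [apply is_series_sum_le with (2 := Hl)|].
  - intros; now apply Cmod2_nonneg.
  - fold N2. lra.
Qed.

(** * Slow oscillation implies boundedness *)

(** Slow oscillation over the integers: the conditions on m and n are symmetric, so the upper bound
    contains the lower one. *)
Definition doubling (beta : nat -> R) (D : R) : Prop :=
  forall m n, (n <= 2 * m)%nat -> (m <= 2 * n)%nat -> beta m <= D * beta n.

Lemma doubling_pos (beta : nat -> R) (D : R) :
  (forall n, 0 < beta n) -> doubling beta D -> 1 <= D.
Proof.
  intros Hb HD. specialize (HD 1%nat 1%nat ltac:(lia) ltac:(lia)). specialize (Hb 1%nat). nra.
Qed.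

(** Passing from m to its upper half costs a factor D and shortens the exponent by [m / 2]; the cost
    is absorbed once lambda^(m/2) >= D. *)
Lemma subexponential (g : nat -> R) (D lambda : R) :
  (forall n, 0 < g n) -> 1 < lambda -> 1 <= D ->
  (forall m, (2 <= m)%nat -> g m <= D * g (m - m / 2)%nat) ->
  exists c, 0 < c /\ forall m, g m <= c * lambda ^ m.
Proof.
  intros Hg Hl HD H.
  destruct (Pow_x_infinity lambda ltac:(rewrite Rabs_pos_eq; lra) D) as [k Hk].
  set (m0 := (2 * k + 2)%nat).
  assert (Hc : forall j, (j <= m0)%nat -> g j <= sum_n g m0).
  { intros j Hj. apply sum_n_ge_term; [|exact Hj]. intros i; left; apply Hg. }
  exists (sum_n g m0).
  assert (Hc0 : 0 < sum_n g m0) by (eapply Rlt_le_trans; [apply (Hg 0%nat)|apply Hc; lia]).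
  split; [exact Hc0|].
  intros m. induction m as [m IH] using (well_founded_induction Wf_nat.lt_wf).
  destruct (Nat.le_gt_cases m m0) as [L|L].
  - apply Rle_trans with (sum_n g m0 * 1); [rewrite Rmult_1_r; now apply Hc|].
    apply Rmult_le_compat_l; [lra|]. apply pow_R1_Rle; lra.
  - assert (Hm : (1 < m)%nat) by (unfold m0 in L; lia).
    assert (D1 : (k <= m / 2)%nat) by (apply Nat.div_le_lower_bound; unfold m0 in L; lia).
    assert (D2 : (m / 2 < m)%nat) by (apply Nat.div_lt; lia).
    assert (D3 : (0 < m / 2)%nat) by (apply Nat.div_str_pos; lia).
    assert (I := IH (m - m / 2)%nat ltac:(lia)).
    assert (K : D <= lambda ^ (m / 2)).
    { specialize (Hk (m / 2)%nat ltac:(lia)).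
      rewrite Rabs_pos_eq in Hk by (apply pow_le; lra). lra. }
    eapply Rle_trans; [apply H; lia|].
    replace (lambda ^ m) with (lambda ^ (m / 2) * lambda ^ (m - m / 2))
      by (rewrite <- pow_add; f_equal; lia).
    assert (0 < g (m - m / 2)%nat) by apply Hg.
    apply Rle_trans with (lambda ^ (m / 2) * g (m - m / 2)%nat).
    + apply Rmult_le_compat_r; lra.
    + assert (0 < lambda ^ (m / 2)) by (apply pow_lt; lra). nra.
Qed.

Lemma doubling_subexponential (beta : nat -> R) (D lambda : R) :
  (forall n, 0 < beta n) -> doubling beta D -> 1 < lambda ->
  exists c, 0 < c /\ forall m n, beta m / beta n <= c * (lambda ^ m * lambda ^ n).
Proof.
  intros Hb HD Hl. assert (HD1 := doubling_pos _ _ Hb HD).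
  assert (half : forall m, (m - m / 2 <= 2 * m /\ m <= 2 * (m - m / 2))%nat).
  { intros m. assert (H := Nat.div_mod_eq m 2). assert (H' := Nat.mod_upper_bound m 2). lia. }
  destruct (subexponential beta D lambda Hb Hl HD1) as [c1 [Hc1 H1]].
  { intros m _. apply HD; apply half. }
  destruct (subexponential (fun n => / beta n) D lambda) as [c2 [Hc2 H2]]; try assumption.
  { intros n. now apply Rinv_0_lt_compat. }
  { intros m _. set (h := (m - m / 2)%nat).
    assert (Hm := Hb m). assert (Hh := Hb h).
    assert (B : beta h <= D * beta m) by (apply HD; apply half).
    apply Rmult_le_reg_l with (beta h * beta m); [now apply Rmult_lt_0_compat|].
    field_simplify; lra. }
  exists (c1 * c2). split; [now apply Rmult_lt_0_compat|].
  intros m n. unfold Rdiv.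
  replace (c1 * c2 * (lambda ^ m * lambda ^ n)) with ((c1 * lambda ^ m) * (c2 * lambda ^ n)) by ring.
  apply Rmult_le_compat; [left; apply Hb|left; apply Rinv_0_lt_compat, Hb|apply H1|apply H2].
Qed.

Lemma doubling_blocks (beta : nat -> R) (D : R) (k : nat) :
  (forall n, 0 < beta n) -> doubling beta D ->
  exists E, 0 < E /\ forall i n,
    (i <= Nat.log2 n + k)%nat -> (Nat.log2 n <= i + k)%nat ->
    beta n <= E * beta (2 ^ i)%nat /\ beta (2 ^ i)%nat <= E * beta n.
Proof.
  intros Hb HD. assert (HD1 := doubling_pos _ _ Hb HD).
  assert (step : forall i d, beta (2 ^ i)%nat <= D ^ d * beta (2 ^ (i + d))%nat /\
    beta (2 ^ (i + d))%nat <= D ^ d * beta (2 ^ i)%nat).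
  { intros i d. induction d as [|d [IH1 IH2]].
    - rewrite Nat.add_0_r. simpl. lra.
    - replace (i + S d)%nat with (S (i + d)) by lia.
      assert (P : (2 ^ S (i + d) = 2 * 2 ^ (i + d))%nat) by reflexivity.
      assert (0 < D ^ d) by (apply pow_lt; lra).
      assert (A1 := HD (2 ^ (i + d))%nat (2 ^ S (i + d))%nat ltac:(lia) ltac:(lia)).
      assert (A2 := HD (2 ^ S (i + d))%nat (2 ^ (i + d))%nat ltac:(lia) ltac:(lia)).
      simpl (D ^ S d). split; nra. }
  assert (pow2 : forall i j, (i <= j + k)%nat -> (j <= i + k)%nat ->
    beta (2 ^ i)%nat <= D ^ k * beta (2 ^ j)%nat).
  { intros i j Hij Hji. destruct (Nat.le_ge_cases i j) as [L|L].
    - destruct (step i (j - i)%nat) as [S1 _]. replace (i + (j - i))%nat with j in S1 by lia.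
      eapply Rle_trans; [exact S1|]. apply Rmult_le_compat_r; [left; apply Hb|].
      apply Rle_pow; [exact HD1|lia].
    - destruct (step j (i - j)%nat) as [_ S1]. replace (j + (i - j))%nat with i in S1 by lia.
      eapply Rle_trans; [exact S1|]. apply Rmult_le_compat_r; [left; apply Hb|].
      apply Rle_pow; [exact HD1|lia]. }
  (* [Nat.log2 0] is 0, so the index 0 shares a block with 1, although [doubling] does not relate
     their weights; the two ratios account for this pair. *)
  set (D0 := D + beta 0%nat / beta 1%nat + beta 1%nat / beta 0%nat).
  assert (B0 := Hb 0%nat). assert (B1 := Hb 1%nat).
  assert (Q1 : 0 < beta 0%nat / beta 1%nat) by now apply Rdiv_lt_0_compat.
  assert (Q2 : 0 < beta 1%nat / beta 0%nat) by now apply Rdiv_lt_0_compat.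
  assert (own : forall n, beta n <= D0 * beta (2 ^ Nat.log2 n)%nat /\
    beta (2 ^ Nat.log2 n)%nat <= D0 * beta n).
  { intros n. destruct (Nat.eq_dec n 0) as [->|Hn].
    - simpl. split.
      + replace (beta 0%nat) with (beta 0%nat / beta 1%nat * beta 1%nat) at 1 by (field; lra).
        apply Rmult_le_compat_r; unfold D0; lra.
      + replace (beta 1%nat) with (beta 1%nat / beta 0%nat * beta 0%nat) at 1 by (field; lra).
        apply Rmult_le_compat_r; unfold D0; lra.
    - destruct (Nat.log2_spec n ltac:(lia)) as [L1 L2]. simpl in L2.
      assert (P := Hb n). assert (P' := Hb (2 ^ Nat.log2 n)%nat).
      split; (eapply Rle_trans; [apply HD|apply Rmult_le_compat_r; unfold D0; lra]); lia. }
  exists (D0 * D ^ k). split; [apply Rmult_lt_0_compat; [unfold D0; lra|apply pow_lt; lra]|].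
  intros i n H1 H2. destruct (own n) as [O1 O2].
  assert (P1 := pow2 i (Nat.log2 n) H1 H2). assert (P2 := pow2 (Nat.log2 n) i H2 H1).
  assert (0 < D ^ k) by (apply pow_lt; lra). assert (0 < D0) by (unfold D0; lra).
  split; nra.
Qed.

Lemma count_window (a b N : nat) :
  sum_n (fun i => if ((a <=? i)%nat && (i <=? a + b)%nat)%bool then 1 else 0) N <= INR (S b).
Proof.
  enough (H : sum_n (fun i => if ((a <=? i)%nat && (i <=? a + b)%nat)%bool then 1 else 0) N <=
    INR (Nat.min (S N - a) (S b))).
  { eapply Rle_trans; [exact H|]. apply le_INR. lia. }
  induction N as [|N IH].
  - rewrite sum_n_0R. destruct (Nat.leb_spec a 0); cbn [andb].
    + destruct (Nat.leb_spec 0 (a + b)); [|lia].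
      replace (Nat.min (1 - a) (S b)) with 1%nat by lia. simpl; lra.
    + apply pos_INR.
  - rewrite sum_n_SR. set (s := sum_n _ N) in *.
    destruct (Nat.leb_spec a (S N)); cbn [andb].
    + destruct (Nat.leb_spec (S N) (a + b)).
      * replace (Nat.min (S (S N) - a) (S b)) with (S (Nat.min (S N - a) (S b))) by lia.
        rewrite S_INR. lra.
      * replace (Nat.min (S (S N) - a) (S b)) with (Nat.min (S N - a) (S b)) by lia. lra.
    + replace (Nat.min (S (S N) - a) (S b)) with (Nat.min (S N - a) (S b)) by lia. lra.
Qed.

Definition near (k i n : nat) : bool :=
  ((i <=? Nat.log2 n + k)%nat && (Nat.log2 n <=? i + k)%nat)%bool.

Lemma near_spec (k i n : nat) :
  near k i n = true <-> (i <= Nat.log2 n + k)%nat /\ (Nat.log2 n <= i + k)%nat.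
Proof.
  unfold near. rewrite Bool.andb_true_iff, !Nat.leb_le. reflexivity.
Qed.

(** On the blocks near a given one the weight is constant up to the factor E, so the unweighted
    bound applies to x restricted to them; each n is met by at most 2 k + 1 values of i. *)
Lemma near_part (r : R) (beta : nat -> R) (D : R) (k : nat) :
  0 <= r < 1 -> (forall n, 0 < beta n) -> doubling beta D ->
  exists M, 0 < M /\ forall (x : nat -> R) (N N' : nat),
    sum_n (fun m => beta m * sum_n (fun n =>
      coef r n m * (if near k (Nat.log2 m) n then x n else 0)) N ^ 2) N' <=
    M * sum_n (fun n => beta n * x n ^ 2) N.
Proof.
  intros Hr Hb HD. destruct (doubling_blocks beta D k Hb HD) as [E [HE HEb]].
  assert (HL := coef_l2_bounded r Hr). set (L := 2 + 4 * r ^ 2 / (1 - r ^ 2)) in *.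
  assert (HL0 : 0 < L).
  { assert (0 <= 4 * r ^ 2 / (1 - r ^ 2)); [|unfold L; lra].
    apply Rmult_le_pos; [nra|]. left. apply Rinv_0_lt_compat. nra. }
  exists (L * E * E * INR (S (2 * k))).
  split; [repeat apply Rmult_lt_0_compat; try assumption; apply lt_0_INR; lia|].
  intros x N N'.
  set (Y := fun i m => sum_n (fun n => coef r n m * (if near k i n then x n else 0)) N).
  (* Row m needs only i = log2 m. The other nonnegative terms are added so that, for each i, the sum
     over all m falls under the unweighted bound. *)
  apply Rle_trans with (sum_n (fun m => sum_n (fun i =>
    E * beta (2 ^ i)%nat * (1 * Y i m ^ 2)) N') N').
  { apply sum_n_leR. intros m Hm.
    apply Rle_trans with (E * beta (2 ^ Nat.log2 m)%nat * (1 * Y (Nat.log2 m) m ^ 2)).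
    - rewrite Rmult_1_l. apply Rmult_le_compat_r; [apply pow2_ge_0|]. apply HEb; lia.
    - apply (sum_n_ge_term (fun i => E * beta (2 ^ i)%nat * (1 * Y i m ^ 2))).
      + intros i. apply Rmult_le_pos; [|rewrite Rmult_1_l; apply pow2_ge_0].
        left. now apply Rmult_lt_0_compat.
      + assert (H := Nat.log2_le_lin m). lia. }
  rewrite sum_n_switch.
  apply Rle_trans with (sum_n (fun i => sum_n (fun n =>
    L * E * E * (beta n * x n ^ 2) * (if near k i n then 1 else 0)) N) N').
  { apply sum_n_leR. intros i _.
    rewrite sum_n_scalR.
    assert (B := HL (fun n => if near k i n then x n else 0) N N').
    apply Rle_trans with (E * beta (2 ^ i)%nat * (L * sum_n (fun n =>
      1 * (if near k i n then x n else 0) ^ 2) N)).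
    { apply Rmult_le_compat_l; [left; now apply Rmult_lt_0_compat|exact B]. }
    rewrite <- !sum_n_scalR. apply sum_n_leR. intros n _.
    destruct (near k i n) eqn:Hn.
    - apply near_spec in Hn. destruct (HEb i n (proj1 Hn) (proj2 Hn)) as [_ B2].
      assert (0 <= L * E * (E * beta n - beta (2 ^ i)%nat) * x n ^ 2).
      { apply Rmult_le_pos; [|apply pow2_ge_0]. apply Rmult_le_pos; [|lra].
        left; now apply Rmult_lt_0_compat. }
      lra.
    - apply Req_le. ring. }
  rewrite sum_n_switch, <- sum_n_scalR.
  apply sum_n_leR. intros n _. rewrite sum_n_scalR.
  replace (L * E * E * INR (S (2 * k)) * (beta n * x n ^ 2)) with
    (L * E * E * (beta n * x n ^ 2) * INR (S (2 * k))) by ring.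
  apply Rmult_le_compat_l.
  { apply Rmult_le_pos; [left; repeat apply Rmult_lt_0_compat; assumption|].
    apply Rmult_le_pos; [left; apply Hb|apply pow2_ge_0]. }
  eapply Rle_trans; [|apply (count_window (Nat.log2 n - k) (2 * k) N')].
  apply sum_n_leR. intros i _. destruct (near k i n) eqn:Hn.
  - apply near_spec in Hn.
    rewrite (proj2 (Nat.leb_le (Nat.log2 n - k) i)) by lia.
    rewrite (proj2 (Nat.leb_le i (Nat.log2 n - k + 2 * k))) by lia. simpl; lra.
  - destruct (_ && _)%bool; lra.
Qed.

(** A gap of more than k blocks means a ratio of at least 2^k > k, which is the separation that
    [coef_decay] asks for. *)
Lemma far_gap (k m n : nat) :
  near k (Nat.log2 m) n = false -> (k * m <= n)%nat \/ (k * n <= m)%nat.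
Proof.
  assert (gap : forall a b, (Nat.log2 a + k < Nat.log2 b)%nat -> (k * a <= b)%nat).
  { intros a b H. destruct (Nat.eq_dec a 0) as [->|Ha]; [lia|].
    destruct (Nat.eq_dec b 0) as [->|Hb]; [change (Nat.log2 0) with 0%nat in H; lia|].
    destruct (Nat.log2_spec a ltac:(lia)) as [_ A].
    destruct (Nat.log2_spec b ltac:(lia)) as [B _].
    assert (P : (2 ^ (S (Nat.log2 a) + k) <= 2 ^ Nat.log2 b)%nat)
      by (apply Nat.pow_le_mono_r; lia).
    rewrite Nat.pow_add_r in P.
    assert (K : (k < 2 ^ k)%nat) by (apply Nat.pow_gt_lin_r; lia). nia. }
  unfold near. intros H. apply Bool.andb_false_iff in H.
  destruct H as [H|H]; apply Nat.leb_gt in H; [right|left]; apply gap; lia.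
Qed.

(** After rescaling by the weights the far matrix is Hilbert-Schmidt: its unweighted entries are at
    most q^max(m,n), so their squares are at most q^m q^n, which beats the subexponential ratio of
    weights. *)
Lemma far_part (r : R) (beta : nat -> R) (D : R) :
  0 <= r < 1 -> (forall n, 0 < beta n) -> doubling beta D ->
  exists (k : nat) (M : R), 0 < M /\ forall (x : nat -> R) (N N' : nat),
    sum_n (fun m => beta m * sum_n (fun n =>
      coef r n m * (if near k (Nat.log2 m) n then 0 else x n)) N ^ 2) N' <=
    M * sum_n (fun n => beta n * x n ^ 2) N.
Proof.
  intros Hr Hb HD. destruct (coef_decay r Hr) as [q [k [Hq [Hk Hdec]]]].
  (* The growth rate is above 1, while q lambda = (1 + q) / 2 stays below 1. *)
  set (lambda := (1 + / q) / 2).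
  assert (Hql : q * lambda = (q + 1) / 2) by (unfold lambda; field; lra).
  assert (Hl : 1 < lambda).
  { assert (1 < / q) by (rewrite <- Rinv_1; apply Rinv_lt_contravar; lra). unfold lambda; lra. }
  destruct (doubling_subexponential beta D lambda Hb HD Hl) as [c [Hc HcB]].
  set (p := (q + 1) / 2) in *. assert (Hp : 0 < p < 1) by (unfold p; lra).
  exists k, (c * (/ (1 - p)) ^ 2).
  assert (Hg : 0 < / (1 - p)) by (apply Rinv_0_lt_compat; lra).
  split; [apply Rmult_lt_0_compat; [exact Hc|now apply pow_lt]|].
  intros x N N'. set (X := sum_n (fun n => beta n * x n ^ 2) N).
  assert (HX : 0 <= X).
  { apply sum_n_ge0. intros; apply Rmult_le_pos; [left; apply Hb|apply pow2_ge_0]. }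
  assert (geo : forall K, sum_n (fun n => p ^ n) K <= / (1 - p)).
  { intros K. apply is_series_sum_le; [intros; apply pow_le; lra|].
    apply is_series_geom. rewrite Rabs_pos_eq; lra. }
  assert (term : forall m n, near k (Nat.log2 m) n = false ->
    beta m / beta n * coef r n m ^ 2 <= c * (p ^ m * p ^ n)).
  { intros m n Hmn.
    assert (A : Rabs (coef r n m) <= q ^ (Nat.max m n)).
    { destruct (Hdec n m) as [D1 D2]. destruct (far_gap k m n Hmn) as [F|F].
      - replace (Nat.max m n) with n by nia. now apply D1.
      - replace (Nat.max m n) with m by nia. now apply D2. }
    assert (A2 : coef r n m ^ 2 <= q ^ m * q ^ n).
    { rewrite <- pow2_abs. apply Rle_trans with (q ^ Nat.max m n * q ^ Nat.max m n).
      - simpl. rewrite Rmult_1_r. apply Rmult_le_compat; auto; apply Rabs_pos.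
      - rewrite <- !pow_add. apply pow_anti; lra || lia. }
    rewrite <- Hql, !Rpow_mult_distr.
    replace (c * (q ^ m * lambda ^ m * (q ^ n * lambda ^ n))) with
      ((c * (lambda ^ m * lambda ^ n)) * (q ^ m * q ^ n)) by ring.
    apply Rmult_le_compat; [|apply pow2_ge_0|apply HcB|exact A2].
    left. now apply Rdiv_lt_0_compat. }
  apply Rle_trans with (sum_n (fun m => c * (/ (1 - p)) * X * p ^ m) N').
  - apply sum_n_leR. intros m _.
    set (w := fun n => coef r n m * (if near k (Nat.log2 m) n then 0 else 1) / sqrt (beta n)).
    assert (CS := sum_n_CS w (fun n => sqrt (beta n) * x n) N).
    assert (E1 : sum_n (fun n => coef r n m * (if near k (Nat.log2 m) n then 0 else x n)) N =
      sum_n (fun n => w n * (sqrt (beta n) * x n)) N).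
    { apply sum_n_ext. intros n. unfold w.
      assert (0 < sqrt (beta n)) by (apply sqrt_lt_R0, Hb).
      destruct (near k (Nat.log2 m) n); real_eq; field; lra. }
    rewrite E1.
    assert (E2 : sum_n (fun n => (sqrt (beta n) * x n) ^ 2) N = X).
    { apply sum_n_ext. intros n. rewrite Rpow_mult_distr, pow2_sqrt by (left; apply Hb).
      reflexivity. }
    cbv beta in CS. rewrite E2 in CS.
    apply Rle_trans with (beta m * (sum_n (fun n => w n ^ 2) N * X)).
    { apply Rmult_le_compat_l; [left; apply Hb|exact CS]. }
    rewrite <- Rmult_assoc. rewrite <- sum_n_scalR.
    replace (c * / (1 - p) * X * p ^ m) with ((c * p ^ m * / (1 - p)) * X) by ring.
    apply Rmult_le_compat_r; [exact HX|].
    apply Rle_trans with (sum_n (fun n => c * p ^ m * p ^ n) N).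
    + apply sum_n_leR. intros n _. unfold w. specialize (term m n).
      assert (Bn := Hb n). assert (Bm := Hb m).
      destruct (near k (Nat.log2 m) n).
      * replace (beta m * (coef r n m * 0 / sqrt (beta n)) ^ 2) with 0 by (unfold Rdiv; ring).
        repeat apply Rmult_le_pos; try lra; apply pow_le; lra.
      * rewrite Rmult_1_r. unfold Rdiv. rewrite Rpow_mult_distr, pow_inv, pow2_sqrt by lra.
        specialize (term eq_refl). unfold Rdiv in term. lra.
    + rewrite sum_n_scalR. apply Rmult_le_compat_l; [|apply geo].
      apply Rmult_le_pos; [lra|apply pow_le; lra].
  - rewrite sum_n_scalR.
    replace (c * (/ (1 - p)) ^ 2 * X) with (c * / (1 - p) * X * / (1 - p)) by ring.
    apply Rmult_le_compat_l; [|apply geo].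
    apply Rmult_le_pos; [apply Rmult_le_pos; lra|exact HX].
Qed.

Lemma doubling_fin_bounded (r : R) (beta : nat -> R) (D : R) :
  0 <= r < 1 -> (forall n, 0 < beta n) -> doubling beta D ->
  exists M, fin_bounded r beta M.
Proof.
  intros Hr Hb HD.
  destruct (far_part r beta D Hr Hb HD) as [k [M1 [HM1 H1]]].
  destruct (near_part r beta D k Hr Hb HD) as [M2 [HM2 H2]].
  exists (2 * M1 + 2 * M2). intros x N N'.
  specialize (H1 x N N'). specialize (H2 x N N').
  rewrite Rmult_plus_distr_r, !Rmult_assoc.
  eapply Rle_trans; [|apply Rplus_le_compat; (apply Rmult_le_compat_l; [lra|eassumption])].
  rewrite <- !sum_n_scalR, <- sum_n_plusR. apply sum_n_leR. intros m _.
  assert (E : sum_n (fun n => coef r n m * x n) N =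
    sum_n (fun n => coef r n m * (if near k (Nat.log2 m) n then 0 else x n)) N +
    sum_n (fun n => coef r n m * (if near k (Nat.log2 m) n then x n else 0)) N).
  { rewrite <- sum_n_plusR. apply sum_n_ext. intros n.
    destruct (near k (Nat.log2 m) n); real_eq; ring. }
  rewrite E. set (u := sum_n (fun n => coef r n m * (if near _ _ n then 0 else x n)) N).
  set (v := sum_n (fun n => coef r n m * (if near _ _ n then x n else 0)) N).
  assert (Bm := Hb m). assert (0 <= (u - v) ^ 2) by apply pow2_ge_0.
  assert (0 <= beta m * (u - v) ^ 2) by (apply Rmult_le_pos; lra). lra.
Qed.

(** * Boundedness implies slow oscillation *)

Lemma sum_n_last (f : nat -> R) (n : nat) :
  (forall k, (k < n)%nat -> f k = 0) -> sum_n f n = f n.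
Proof.
  intros H. destruct n as [|n]; [apply sum_n_0R|].
  rewrite sum_n_SR. rewrite (sum_n_ext_loc f (fun _ => 0)) by (intros; apply H; lia).
  rewrite sum_n_const. real_eq. ring.
Qed.

Lemma col_bound (r : R) (beta : nat -> R) (M : R) (n N : nat) :
  fin_bounded r beta M ->
  sum_n (fun m => beta m * coef r n m ^ 2) N <= M * beta n.
Proof.
  intros H. specialize (H (fun k => if Nat.eqb k n then 1 else 0) n N).
  cbv beta in H.
  assert (E : forall f : nat -> R -> R, (forall k, f k 0 = 0) ->
    sum_n (fun k => f k (if Nat.eqb k n then 1 else 0)) n = f n 1).
  { intros f Hf. rewrite sum_n_last.
    - now rewrite Nat.eqb_refl.
    - intros k Hk. rewrite (proj2 (Nat.eqb_neq k n)) by lia. apply Hf. }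
  rewrite (E (fun k t => beta k * t ^ 2)) in H by (intros; ring).
  replace (M * beta n) with (M * (beta n * 1 ^ 2)) by ring.
  eapply Rle_trans; [|exact H]. apply Req_le, sum_n_ext. intros m.
  rewrite (E (fun k t => coef r k m * t)) by (intros; ring). real_eq. ring.
Qed.

(** The column estimate of the adjoint: for the test vector x_n = [coef r n m / beta n], the sum s
    is both the squared norm of x and the m-th coordinate of its image, whence beta_m s^2 <= M s. *)
Lemma row_bound (r : R) (beta : nat -> R) (M : R) (m N : nat) :
  (forall n, 0 < beta n) -> 0 < M -> fin_bounded r beta M ->
  sum_n (fun n => coef r n m ^ 2 / beta n) N <= M / beta m.
Proof.
  intros Hb HM H. specialize (H (fun n => coef r n m / beta n) N m). cbv beta in H.
  set (s := sum_n (fun n => coef r n m ^ 2 / beta n) N).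
  assert (E1 : sum_n (fun n => beta n * (coef r n m / beta n) ^ 2) N = s).
  { apply sum_n_ext. intros n. specialize (Hb n). real_eq. field. lra. }
  rewrite E1 in H.
  assert (E2 : beta m * s ^ 2 <= M * s).
  { eapply Rle_trans; [|exact H].
    replace s with (sum_n (fun n => coef r n m * (coef r n m / beta n)) N).
    - apply (sum_n_ge_term (fun m0 => beta m0 *
        sum_n (fun n => coef r n m0 * (coef r n m / beta n)) N ^ 2)); [|lia].
      intros j. apply Rmult_le_pos; [left; apply Hb|apply pow2_ge_0].
    - apply sum_n_ext. intros n. specialize (Hb n). real_eq. field. lra. }
  assert (Bm := Hb m).
  assert (0 < M / beta m) by now apply Rdiv_lt_0_compat.
  destruct (Rle_or_lt s 0) as [L|L]; [lra|].
  apply Rmult_le_reg_l with (beta m * s); [now apply Rmult_lt_0_compat|].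
  replace (beta m * s * (M / beta m)) with (M * s) by (field; lra).
  replace (beta m * s * s) with (beta m * s ^ 2) by ring. exact E2.
Qed.

(** Cauchy-Schwarz with the weight split between the factors: delta^2 <= (a / x) (b y). It compares
    two weights x and y, reached through a row P and a column Q of the matrix. *)
Lemma weighted_link (beta P Q : nat -> R) (x y a b delta : R) (J : nat) :
  (forall n, 0 < beta n) -> 0 < x -> 0 < y -> 0 < delta ->
  delta <= sum_n (fun j => P j * Q j) J ->
  sum_n (fun j => P j ^ 2 / beta j) J <= a / x ->
  sum_n (fun j => beta j * Q j ^ 2) J <= b * y ->
  x <= a * b / delta ^ 2 * y.
Proof.
  intros Hb Hx Hy Hd HPQ HP HQ.
  assert (CS := sum_n_CS (fun j => P j / sqrt (beta j)) (fun j => sqrt (beta j) * Q j) J).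
  cbv beta in CS.
  assert (Hs : forall j, 0 < sqrt (beta j)) by (intros; apply sqrt_lt_R0, Hb).
  rewrite (sum_n_ext (fun j => P j / sqrt (beta j) * (sqrt (beta j) * Q j))
    (fun j => P j * Q j)) in CS by (intros j; specialize (Hs j); real_eq; field; lra).
  rewrite (sum_n_ext (fun j => (P j / sqrt (beta j)) ^ 2) (fun j => P j ^ 2 / beta j)) in CS.
  2: { intros j. unfold Rdiv. rewrite Rpow_mult_distr, pow_inv, pow2_sqrt by (left; apply Hb).
       reflexivity. }
  rewrite (sum_n_ext (fun j => (sqrt (beta j) * Q j) ^ 2) (fun j => beta j * Q j ^ 2)) in CS.
  2: { intros j. rewrite Rpow_mult_distr, pow2_sqrt by (left; apply Hb). reflexivity. }
  assert (0 <= sum_n (fun j => P j ^ 2 / beta j) J).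
  { apply sum_n_ge0. intros k _. apply Rmult_le_pos; [apply pow2_ge_0|].
    left. apply Rinv_0_lt_compat, Hb. }
  assert (0 <= sum_n (fun j => beta j * Q j ^ 2) J).
  { apply sum_n_ge0. intros k _. apply Rmult_le_pos; [left; apply Hb|apply pow2_ge_0]. }
  assert (D2 : delta ^ 2 <= a / x * (b * y)).
  { apply Rle_trans with (sum_n (fun j => P j * Q j) J ^ 2).
    - apply pow_incr. lra.
    - eapply Rle_trans; [exact CS|]. apply Rmult_le_compat; assumption. }
  assert (0 < delta ^ 2) by now apply pow_lt.
  apply Rmult_le_reg_l with (delta ^ 2 / x); [now apply Rdiv_lt_0_compat|].
  replace (delta ^ 2 / x * x) with (delta ^ 2) by (field; lra).
  replace (delta ^ 2 / x * (a * b / delta ^ 2 * y)) with (a / x * (b * y)) by (field; lra).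
  exact D2.
Qed.

(* The Gram matrix of the powers of [T] has the nonzero entry [r] next to the
   diagonal; all but an exponentially small part of this inner product comes
   from indices [j] comparable with [a]. *)
Lemma gram_row_col (r : R) :
  0 < r < 1 ->
  exists (delta : R) (m0 : nat), 0 < delta /\ forall a b : nat,
    (m0 <= a)%nat -> (a <= S b)%nat ->
    is_series (fun j => coef r a j * coef r b j) r ->
    exists J, delta <= sum_n (fun j => Rabs (coef r j a) * Rabs (coef r b j)) J.
Proof.
  intros Hr. assert (Hr0 : 0 <= r < 1) by lra.
  destruct (coef_decay r Hr0) as [q [k [Hq [Hk Hdec]]]].
  assert (Hk0 : 0 < INR k) by now apply lt_0_INR.
  assert (Hk1 : 1 <= INR k) by (apply (le_INR 1); lia).
  (* A partial sum retains half of the Gram entry r, passing from a column to a row costs 2 k, and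
     half of the outcome pays for the exponential remainder. *)
  set (delta := r / (8 * INR k)).
  assert (Hdelta : 0 < delta) by (apply Rdiv_lt_0_compat; lra).
  destruct (pow_lt_1_zero q ltac:(rewrite Rabs_pos_eq; lra) ((1 - q) * delta)
    ltac:(apply Rmult_lt_0_compat; lra)) as [m1 Hm1].
  (* [m1] makes the remainder small; 2 k excludes j = 0 when a < k j + k, so that a <= 2 k j
     follows. *)
  exists delta, (m1 + 2 * k)%nat. split; [exact Hdelta|].
  intros a b Ha Hab HS.
  assert (Ha0 : 0 < INR a) by (apply lt_0_INR; lia).
  assert (Hqa : q ^ a * / (1 - q) <= delta).
  { specialize (Hm1 a ltac:(lia)). rewrite Rabs_pos_eq in Hm1 by (apply pow_le; lra).
    apply Rmult_le_reg_l with (1 - q); [lra|].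
    replace ((1 - q) * (q ^ a * / (1 - q))) with (q ^ a) by (field; lra). lra. }
  assert (term : forall j, / (2 * INR k) * (coef r a j * coef r b j) - q ^ a * q ^ j <=
    Rabs (coef r j a) * Rabs (coef r b j)).
  { intros j. assert (Pq : 0 <= q ^ a * q ^ j) by (apply Rmult_le_pos; apply pow_le; lra).
    assert (Hik : 0 < / (2 * INR k) <= 1).
    { split; [apply Rinv_0_lt_compat; lra|].
      rewrite <- Rinv_1. apply Rinv_le_contravar; lra. }
    assert (Ab : coef r a j * coef r b j <= Rabs (coef r a j) * Rabs (coef r b j))
      by (rewrite <- Rabs_mult; apply Rle_abs).
    (* The extra k lets the decay apply to the power b as well, of which only b >= a - 1 is
       known. *)
    destruct (Nat.le_gt_cases (k * j + k) a) as [L|L].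
    - assert (A1 := proj1 (Hdec a j) ltac:(lia)).
      assert (B1 := proj1 (Hdec b j) ltac:(lia)).
      assert (B2 : q ^ b <= q ^ j) by (apply pow_anti; [lra|nia]).
      assert (0 <= Rabs (coef r j a) * Rabs (coef r b j)) by (apply Rmult_le_pos; apply Rabs_pos).
      assert (Rabs (coef r a j) * Rabs (coef r b j) <= q ^ a * q ^ j).
      { apply Rmult_le_compat; try apply Rabs_pos; lra. }
      assert (/ (2 * INR k) * (coef r a j * coef r b j) <= 1 * (q ^ a * q ^ j)); [|lra].
      apply Rle_trans with (/ (2 * INR k) * (q ^ a * q ^ j)).
      + apply Rmult_le_compat_l; lra.
      + apply Rmult_le_compat_r; lra.
    - assert (J : INR a <= 2 * INR k * INR j).
      { assert (H : (a <= 2 * k * j)%nat) by lia.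
        apply le_INR in H. rewrite !mult_INR in H. exact H. }
      assert (E := coef_sym_abs r a j).
      assert (X : / (2 * INR k) * Rabs (coef r a j) <= Rabs (coef r j a)).
      { assert (0 <= Rabs (coef r a j)) by apply Rabs_pos.
        apply Rmult_le_reg_l with (INR a); [exact Ha0|]. rewrite <- E.
        replace (INR a * (/ (2 * INR k) * Rabs (coef r a j))) with
          ((INR a * / (2 * INR k)) * Rabs (coef r a j)) by ring.
        apply Rmult_le_compat_r; [assumption|].
        apply Rmult_le_reg_r with (2 * INR k); [lra|].
        rewrite Rmult_assoc, Rinv_l; lra. }
      assert (/ (2 * INR k) * (coef r a j * coef r b j) <=
        Rabs (coef r j a) * Rabs (coef r b j)); [|lra].
      apply Rle_trans with (/ (2 * INR k) * (Rabs (coef r a j) * Rabs (coef r b j))).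
      + apply Rmult_le_compat_l; lra.
      + rewrite <- Rmult_assoc. apply Rmult_le_compat_r; [apply Rabs_pos|exact X]. }
  apply is_series_lim_seq, is_lim_seq_spec in HS.
  destruct (HS (mkposreal (r / 2) ltac:(lra))) as [J HJ].
  specialize (HJ J (le_n J)). simpl in HJ. apply Rabs_lt_between in HJ.
  exists J.
  eapply Rle_trans; [|apply sum_n_leR; intros j _; apply term].
  rewrite (sum_n_ext (fun j => / (2 * INR k) * (coef r a j * coef r b j) - q ^ a * q ^ j)
    (fun j => / (2 * INR k) * (coef r a j * coef r b j) + - q ^ a * q ^ j))
    by (intros; real_eq; ring).
  rewrite sum_n_plusR, !sum_n_scalR.
  change (sum_n (pow q) J) with (sum_n (fun j => q ^ j) J).
  assert (geo : sum_n (fun j => q ^ j) J <= / (1 - q)).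
  { apply is_series_sum_le; [intros; apply pow_le; lra|].
    apply is_series_geom. rewrite Rabs_pos_eq; lra. }
  assert (q ^ a * sum_n (fun j => q ^ j) J <= delta).
  { eapply Rle_trans; [|exact Hqa]. apply Rmult_le_compat_l; [apply pow_le; lra|exact geo]. }
  assert (2 * delta <= / (2 * INR k) * sum_n (fun j => coef r a j * coef r b j) J).
  { replace (2 * delta) with (/ (2 * INR k) * (r / 2)) by (unfold delta; field; lra).
    apply Rmult_le_compat_l; [left; apply Rinv_0_lt_compat; lra|lra]. }
  lra.
Qed.

(** The Gram entry is used in both orders, (m, m + 1) and (m + 1, m); the finitely many m below [m0]
    enter the constant through [s]. *)
Lemma adjacent_comparable (r : R) (beta : nat -> R) (M : R) :
  0 < r < 1 -> (forall n, 0 < beta n) -> 0 < M -> fin_bounded r beta M ->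
  exists D, 1 <= D /\ forall m, beta m <= D * beta (S m) /\ beta (S m) <= D * beta m.
Proof.
  intros Hr Hb HM HF.
  destruct (gram_row_col r Hr) as [delta [m0 [Hdelta HG]]].
  set (K := M * M / delta ^ 2).
  assert (link : forall a b, (m0 <= a)%nat -> (a <= S b)%nat ->
    is_series (fun j => coef r a j * coef r b j) r -> beta a <= K * beta b).
  { intros a b Ha Hab HS. destruct (HG a b Ha Hab HS) as [J HJ].
    apply (weighted_link beta (fun j => Rabs (coef r j a)) (fun j => Rabs (coef r b j))
      _ _ _ _ delta J Hb (Hb a) (Hb b) Hdelta HJ).
    - eapply Rle_trans; [|apply (row_bound r beta M a J Hb HM HF)].
      apply Req_le, sum_n_ext. intros n. now rewrite pow2_abs.
    - eapply Rle_trans; [|apply (col_bound r beta M b J HF)].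
      apply Req_le, sum_n_ext. intros n. now rewrite pow2_abs. }
  set (s := sum_n (fun m => beta m / beta (S m) + beta (S m) / beta m) m0).
  assert (pos : forall m m', 0 < beta m / beta m') by (intros; apply Rdiv_lt_0_compat; apply Hb).
  assert (HK : 0 < K).
  { apply Rdiv_lt_0_compat; [now apply Rmult_lt_0_compat|now apply pow_lt]. }
  assert (Hs : 0 <= s).
  { apply sum_n_ge0. intros m _. assert (A := pos m (S m)). assert (B := pos (S m) m). lra. }
  exists (1 + K + s). split; [lra|].
  intros m. assert (B0 := Hb m). assert (B1 := Hb (S m)).
  destruct (Nat.le_gt_cases m0 m) as [L|L].
  - assert (G := coef_gram r m Hr). split.
    + apply Rle_trans with (K * beta (S m)); [|apply Rmult_le_compat_r; lra].
      apply link; [lia|lia|exact G].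
    + apply Rle_trans with (K * beta m); [|apply Rmult_le_compat_r; lra].
      apply link; [lia|lia|]. revert G. apply is_series_ext. intros; apply Rmult_comm.
  - assert (A := pos m (S m)). assert (B := pos (S m) m).
    assert (T : beta m / beta (S m) + beta (S m) / beta m <= s).
    { apply (sum_n_ge_term (fun m => beta m / beta (S m) + beta (S m) / beta m)); [|lia].
      intros j. assert (A' := pos j (S j)). assert (B' := pos (S j) j). lra. }
    split.
    + replace (beta m) with (beta m / beta (S m) * beta (S m)) at 1 by (field; lra).
      apply Rmult_le_compat_r; lra.
    + replace (beta (S m)) with (beta (S m) / beta m * beta m) at 1 by (field; lra).
      apply Rmult_le_compat_r; lra.
Qed.

(** * Oscillation and lower bounds for the coefficients *)

(* The coefficients of [T ^ n T'], in the form given by [coef_sym]. *)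
Definition coefV (r : R) (n m : nat) : R := (-1) ^ (n + m) * coef r (S m) (S n).

Lemma coefV_tau (r : R) (n m : nat) : coefV r (S n) m = tau r (coefV r n) m.
Proof.
  apply tau_unique.
  - unfold coefV. rewrite !coef_1, !Nat.add_0_r. simpl. ring.
  - clear m. intros m. unfold coefV.
    replace (S n + S m)%nat with (S (S (n + m))) by lia.
    replace (S n + m)%nat with (S (n + m)) by lia.
    replace (n + S m)%nat with (S (n + m)) by lia.
    rewrite (coef_SS r (S m) (S n)). simpl pow. ring.
Qed.

Lemma coefV_deriv (r : R) (n m : nat) :
  INR (S m) * coef r (S n) (S m) = INR (S n) * coefV r n m.
Proof.
  rewrite coef_sym. unfold coefV.
  replace (S n + S m)%nat with (S (S (n + m))) by lia. simpl pow. ring.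
Qed.

Lemma coefV_sq (r : R) (n m : nat) : coefV r n m ^ 2 = coef r (S m) (S n) ^ 2.
Proof.
  unfold coefV. rewrite Rpow_mult_distr.
  replace (((-1) ^ (n + m)) ^ 2) with 1; [ring|].
  rewrite <- (pow_m1_sq (n + m)). ring.
Qed.

(** Up to sign [coefV r n] is part of a row of the matrix, so the row estimate for the weight 1
    gives a bound uniform in n. *)
Lemma coefV_l2 (r : R) :
  0 <= r < 1 ->
  exists L, 0 < L /\ forall n, exists s : R, is_series (fun m => coefV r n m ^ 2) s /\ s <= L.
Proof.
  intros Hr. set (L := 2 + 4 * r ^ 2 / (1 - r ^ 2)).
  assert (HL : 0 < L).
  { assert (0 <= 4 * r ^ 2 / (1 - r ^ 2)); [|unfold L; lra].
    apply Rmult_le_pos; [nra|]. left. apply Rinv_0_lt_compat. nra. }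
  exists L. split; [exact HL|]. intros n.
  apply ex_series_bounded; [intros; apply pow2_ge_0|].
  intros N.
  assert (B := row_bound r (fun _ => 1) L (S n) (S N) (fun _ => Rlt_0_1) HL (coef_l2_bounded r Hr)).
  rewrite sum_n_head in B. unfold Rdiv in B at 3. rewrite Rinv_1, Rmult_1_r in B.
  assert (0 <= coef r 0 (S n) ^ 2 / 1) by (unfold Rdiv; rewrite Rinv_1, Rmult_1_r; apply pow2_ge_0).
  apply Rle_trans with (sum_n (fun k => coef r (S k) (S n) ^ 2 / 1) N); [|lra].
  apply sum_n_leR. intros k _. rewrite coefV_sq. unfold Rdiv. rewrite Rinv_1. lra.
Qed.

(* The sequence being squared is that of the coefficients of
   [(1 - z ^ 2) T ^ n T'], whose norm does not depend on [n]. *)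
Lemma edge_series (r : R) (n : nat) :
  0 <= r < 1 ->
  exists w : R, (1 - r ^ 2) ^ 2 <= w /\
    is_series (fun m => (coefV r n m - shift (shift (coefV r n)) m) ^ 2) w.
Proof.
  intros Hr. set (W := fun n m => coefV r n m - shift (shift (coefV r n)) m).
  destruct (coefV_l2 r Hr) as [L [HL HV]]. destruct (HV 0%nat) as [s [Hs _]].
  assert (Hs1 : is_series (fun m => shift (shift (coefV r 0)) m ^ 2) s).
  { apply is_series_head, is_series_head. simpl.
    replace (s - 0 * (0 * 1) - 0 * (0 * 1)) with s by ring. exact Hs. }
  assert (Hs2 := is_series_plusR _ _ _ _ (is_series_scalR 2 _ _ Hs) (is_series_scalR 2 _ _ Hs1)).
  destruct (ex_series_bounded (fun m => W 0%nat m ^ 2) (2 * s + 2 * s)) as [w [Hw _]].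
  { intros; apply pow2_ge_0. }
  { intros N. eapply Rle_trans; [|apply (is_series_sum_le _ _ N) with (2 := Hs2)].
    - apply sum_n_leR. intros m _. unfold W.
      assert (0 <= (coefV r 0 m + shift (shift (coefV r 0)) m) ^ 2) by apply pow2_ge_0. lra.
    - intros m. assert (0 <= coefV r 0 m ^ 2) by apply pow2_ge_0.
      assert (0 <= shift (shift (coefV r 0)) m ^ 2) by apply pow2_ge_0. lra. }
  exists w. split.
  (* The lower bound is the single term m = 0 at n = 0, where the coefficient is T'(0) = 1 - r^2. *)
  - replace ((1 - r ^ 2) ^ 2) with (sum_n (fun m => W 0%nat m ^ 2) 0).
    + apply is_series_sum_le; [intros; apply pow2_ge_0|exact Hw].
    + rewrite sum_n_0R. unfold W, coefV. rewrite coef_1. simpl. real_eq. ring.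
  - fold (W n). change (is_series (fun m => W n m ^ 2) w). induction n as [|n IH]; [exact Hw|].
    apply (is_series_ext (fun m => tau r (W n) m ^ 2)).
    + intros m. f_equal. unfold W.
      rewrite (tau_ext r _ (fun k => 1 * coefV r n k + (-1) * shift (shift (coefV r n)) k))
        by (intros; ring).
      rewrite tau_lin, tau_shift, coefV_tau.
      assert (E : forall k, shift (tau r (shift (coefV r n))) k = shift (shift (coefV r (S n))) k).
      { intros k. destruct k as [|k]; [reflexivity|]. simpl. rewrite tau_shift.
        destruct k as [|k]; [reflexivity|]. simpl. symmetry. apply coefV_tau. }
      rewrite E. ring.
    + now apply tau_isometry.
Qed.

(* The factor [q] of the recurrence [v_{m+1} + v_{m-1} = q v_m] of [coefV r n], as a
   function of [t = (m + 1) / (n + 1)]. *)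
Definition rec_coef (r t : R) : R := ((1 - r ^ 2) / t - (1 + r ^ 2)) / r.

Lemma coefV_rec (r : R) (n m : nat) :
  0 < r ->
  coefV r n (S m) + shift (coefV r n) m =
  rec_coef r (INR (S m) / INR (S n)) * coefV r n m.
Proof.
  intros Hr. assert (T := coef_three_term r (S n) m).
  assert (Pn : 0 < INR (S n)) by (apply lt_0_INR; lia).
  assert (Pm : 0 < INR (S m)) by (apply lt_0_INR; lia).
  rewrite coefV_deriv in T.
  assert (Es : INR m * coef r (S n) m = INR (S n) * shift (coefV r n) m).
  { destruct m as [|m]; [simpl; ring|]. apply coefV_deriv. }
  rewrite Es in T.
  assert (Ec : coef r (S n) (S m) = INR (S n) * coefV r n m / INR (S m)).
  { rewrite <- coefV_deriv. field. lra. }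
  rewrite Ec in T. unfold rec_coef.
  apply Rmult_eq_reg_l with (r * INR (S n)); [|apply Rgt_not_eq, Rmult_lt_0_compat; lra].
  transitivity (r * (INR (S n) * coefV r n (S m)) + r * (INR (S n) * shift (coefV r n) m)); [ring|].
  rewrite T. field. lra.
Qed.

(* [4 - q ^ 2] is positive only in the oscillatory range of the recurrence. *)
Lemma bulk_mass (r : R) (n : nat) :
  0 < r < 1 ->
  exists P : R, (1 - r ^ 2) ^ 2 <= P /\
    is_series (fun m => (4 - rec_coef r (INR (S m) / INR (S n)) ^ 2) * coefV r n m ^ 2) P.
Proof.
  intros Hr. assert (Hr0 : 0 <= r < 1) by lra.
  destruct (edge_series r n Hr0) as [w [Hw HW]].
  destruct (coefV_l2 r Hr0) as [L [HL HV]]. destruct (HV n) as [s [Hs _]].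
  set (v := coefV r n) in *.
  exists (w + v 0%nat ^ 2). split; [assert (0 <= v 0%nat ^ 2) by apply pow2_ge_0; lra|].
  assert (Hs1 : is_series (fun m => v (S m) ^ 2) (s - v 0%nat ^ 2)) by now apply is_series_head in Hs.
  assert (Hs2 : is_series (fun m => shift v m ^ 2) s).
  { apply is_series_head. simpl. replace (s - 0 * (0 * 1)) with s by ring. exact Hs. }
  apply is_series_head in HW. change (shift (shift v) 0) with 0 in HW.
  (* The parallelogram law rewrites (v_{m+1} + v_{m-1})^2, which is (q v_m)^2 by the recurrence, as
     2 v_{m+1}^2 + 2 v_{m-1}^2 - (v_{m+1} - v_{m-1})^2. *)
  assert (K := is_series_plusR _ _ _ _ (is_series_plusR _ _ _ _ (is_series_plusR _ _ _ _
    (is_series_scalR 4 _ _ Hs) (is_series_scalR (-2) _ _ Hs1)) (is_series_scalR (-2) _ _ Hs2)) HW).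
  replace (w + v 0%nat ^ 2) with
    (4 * s + -2 * (s - v 0%nat ^ 2) + -2 * s + (w - (v 0%nat - 0) ^ 2)) by ring.
  revert K. apply is_series_ext. intros m.
  assert (E := coefV_rec r n m (proj1 Hr)). fold v in E.
  set (q := rec_coef _ _) in *. change (shift (shift v) (S m)) with (shift v m).
  real_eq. replace ((4 - q ^ 2) * v m ^ 2) with (4 * v m ^ 2 - (q * v m) ^ 2) by ring.
  rewrite <- E. ring.
Qed.

(** [rec_coef r] decreases in t, and the end points are where it equals 2 - eps and -(2 - eps). As
    eps tends to 0 they tend to (1 - r) / (1 + r) and (1 + r) / (1 - r), the extreme values of |T'|
    on the unit circle. *)
Lemma rec_coef_bulk (r eps : R) :
  0 < r < 1 -> 0 < eps < 1 ->
  exists a b, 0 < a < b /\ forall t, 0 < t ->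
    (a <= t <= b <-> -(2 - eps) <= rec_coef r t <= 2 - eps).
Proof.
  intros Hr He.
  assert (D1 : 0 < 1 + r ^ 2 - r * (2 - eps)) by nra.
  assert (D2 : 0 < 1 + r ^ 2 + r * (2 - eps)) by nra.
  assert (N : 0 < 1 - r ^ 2) by nra.
  exists ((1 - r ^ 2) / (1 + r ^ 2 + r * (2 - eps))), ((1 - r ^ 2) / (1 + r ^ 2 - r * (2 - eps))).
  assert (A1 : forall t d, 0 < t -> 0 < d -> (t <= (1 - r ^ 2) / d <-> d <= (1 - r ^ 2) / t)).
  { intros t d Ht Hd. split; intros H.
    - apply Rmult_le_reg_l with t; [exact Ht|]. replace (t * ((1 - r ^ 2) / t)) with (1 - r ^ 2)
        by (field; lra).
      apply Rmult_le_compat_r with (r := d) in H; [|lra].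
      replace ((1 - r ^ 2) / d * d) with (1 - r ^ 2) in H by (field; lra). lra.
    - apply Rmult_le_reg_l with d; [exact Hd|]. replace (d * ((1 - r ^ 2) / d)) with (1 - r ^ 2)
        by (field; lra).
      apply Rmult_le_compat_r with (r := t) in H; [|lra].
      replace ((1 - r ^ 2) / t * t) with (1 - r ^ 2) in H by (field; lra). lra. }
  assert (A2 : forall t d, 0 < t -> 0 < d -> ((1 - r ^ 2) / d <= t <-> (1 - r ^ 2) / t <= d)).
  { intros t d Ht Hd. split; intros H.
    - apply Rmult_le_reg_l with t; [exact Ht|]. replace (t * ((1 - r ^ 2) / t)) with (1 - r ^ 2)
        by (field; lra).
      apply Rmult_le_compat_r with (r := d) in H; [|lra].
      replace ((1 - r ^ 2) / d * d) with (1 - r ^ 2) in H by (field; lra). lra.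
    - apply Rmult_le_reg_l with d; [exact Hd|]. replace (d * ((1 - r ^ 2) / d)) with (1 - r ^ 2)
        by (field; lra).
      apply Rmult_le_compat_r with (r := t) in H; [|lra].
      replace ((1 - r ^ 2) / t * t) with (1 - r ^ 2) in H by (field; lra). lra. }
  split; [split|].
  - now apply Rdiv_lt_0_compat.
  - apply Rmult_lt_compat_l; [exact N|]. apply Rinv_lt_contravar; nra.
  - intros t Ht. rewrite (A1 t _ Ht D1), (A2 t _ Ht D2).
    assert (E : rec_coef r t * r = (1 - r ^ 2) / t - (1 + r ^ 2))
      by (unfold rec_coef; field; lra).
    split; intros [H1 H2]; split; nra.
Qed.

(* In the oscillatory range of the recurrence the quadratic form
   [v_{m+1}^2 + v_m^2 - q_m v_m v_{m+1}] is an almost conserved energy. *)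
Lemma bulk_energy (r : R) :
  0 < r < 1 ->
  exists a b c, 0 < a < b /\ 0 < c /\ forall n m,
    a * INR (S n) <= INR (S m) <= b * INR (S n) ->
    c / INR (S n) <= coefV r n m ^ 2 + coefV r n (S m) ^ 2.
Proof.
  intros Hr. assert (Hr0 : 0 <= r < 1) by lra.
  destruct (coefV_l2 r Hr0) as [L [HL HV]].
  set (k := (1 - r ^ 2) ^ 2).
  assert (N : 0 < 1 - r ^ 2) by nra.
  assert (Hk : 0 < k) by (apply pow_lt; exact N).
  assert (Hk1 : k <= 1) by (unfold k; nra).
  (* The total mass in [bulk_mass] is at least k. Outside the bulk 4 - q^2 < 4 eps, so that part is
     at most 4 eps L <= k / 2; if v_m^2 < c1 / (n + 1) throughout the bulk, the bulk would add at
     most k / 4. *)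
  set (eps := k / (8 * L + 8)).
  assert (He0 : eps * (8 * L + 8) = k) by (unfold eps; field; lra).
  assert (He : 0 < eps < 1) by (split; [apply Rdiv_lt_0_compat; lra|nra]).
  destruct (rec_coef_bulk r eps Hr He) as [a [b [Hab Hbulk]]].
  set (c1 := k / (16 * (b + 1))).
  assert (Hc1 : 0 < c1) by (apply Rdiv_lt_0_compat; lra).
  (* h / (n + 1) will bound the relative change of the energy in one step; the bulk ends at b (n +
     1), so chaining costs at most exp (h b). *)
  set (h := (1 - r ^ 2) / (r * a ^ 2 * eps)).
  assert (Ha2 : 0 < a ^ 2) by (apply pow_lt; lra).
  assert (Hh : 0 < h).
  { apply Rdiv_lt_0_compat; [exact N|].
    apply Rmult_lt_0_compat; [apply Rmult_lt_0_compat|]; lra. }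
  exists a, b, (eps / 4 * c1 * exp (- (h * b))).
  split; [exact Hab|]. split.
  { apply Rmult_lt_0_compat; [apply Rmult_lt_0_compat; lra|apply exp_pos]. }
  intros n.
  set (nn := INR (S n)). assert (Hn : 0 < nn) by (apply lt_0_INR; lia).
  assert (Hn1 : 1 <= nn) by (unfold nn; rewrite S_INR; assert (0 <= INR n) by apply pos_INR; lra).
  set (v := coefV r n). set (q := fun m => rec_coef r (INR (S m) / nn)).
  set (G := fun m => a * nn <= INR (S m) <= b * nn).
  assert (HG : forall m, G m <-> -(2 - eps) <= q m <= 2 - eps).
  { intros m. unfold q. rewrite <- Hbulk.
    - unfold G. split; intros [H1 H2]; split.
      + apply Rmult_le_reg_r with nn; [exact Hn|]. unfold Rdiv. rewrite Rmult_assoc, Rinv_l; lra.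
      + apply Rmult_le_reg_r with nn; [exact Hn|]. unfold Rdiv. rewrite Rmult_assoc, Rinv_l; lra.
      + replace (INR (S m)) with (INR (S m) / nn * nn) by (field; lra).
        apply Rmult_le_compat_r; lra.
      + replace (INR (S m)) with (INR (S m) / nn * nn) by (field; lra).
        apply Rmult_le_compat_r; lra.
    - apply Rdiv_lt_0_compat; [apply lt_0_INR; lia|exact Hn]. }
  assert (big : exists m0, G m0 /\ c1 / nn <= v m0 ^ 2).
  { apply Classical_Prop.NNPP. intros Hno.
    destruct (bulk_mass r n Hr) as [P [HP HPs]]. fold v nn in HPs.
    destruct (HV n) as [s [Hs HsL]]. fold v in Hs.
    destruct (nfloor_ex (b * nn) ltac:(apply Rmult_le_pos; lra)) as [B [HB1 HB2]].
    assert (Ecut : sum_n (fun m => if Nat.leb m B then 4 * (c1 / nn) else 0) B =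
      (INR B + 1) * (4 * (c1 / nn))).
    { rewrite (sum_n_ext_loc _ (fun _ => 4 * (c1 / nn))).
      - rewrite sum_n_const, S_INR. reflexivity.
      - intros m Hm. now rewrite (proj2 (Nat.leb_le m B) Hm). }
    assert (Hcut : is_series (fun m => if Nat.leb m B then 4 * (c1 / nn) else 0)
      ((INR B + 1) * (4 * (c1 / nn)))).
    { rewrite <- Ecut. apply is_series_eventually_0. intros m Hm.
      now rewrite (proj2 (Nat.leb_gt m B) Hm). }
    assert (Hsum := is_series_plusR _ _ _ _ (is_series_scalR (4 * eps) _ _ Hs) Hcut).
    assert (K' : P <= 4 * eps * s + (INR B + 1) * (4 * (c1 / nn))).
    { refine (is_series_le _ _ _ _ _ HPs Hsum). intros m. cbv beta.
      assert (V2 : 0 <= v m ^ 2) by apply pow2_ge_0.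
      assert (Hcn : 0 < c1 / nn) by now apply Rdiv_lt_0_compat.
      fold (q m).
      destruct (Classical_Prop.classic (G m)) as [Gm|Gm].
      - assert (Hv : v m ^ 2 < c1 / nn).
        { apply Rnot_le_lt. intros H. apply Hno. now exists m. }
        rewrite (proj2 (Nat.leb_le m B)).
        + assert (0 <= q m ^ 2 * v m ^ 2) by (apply Rmult_le_pos; apply pow2_ge_0).
          assert (0 <= 4 * eps * v m ^ 2) by (apply Rmult_le_pos; lra). lra.
        + apply INR_le. destruct Gm as [_ Gm]. rewrite S_INR in Gm. lra.
      - assert (Q : (4 - q m ^ 2) * v m ^ 2 <= 4 * eps * v m ^ 2).
        { apply Rmult_le_compat_r; [exact V2|].
          destruct (Rle_or_lt (q m) (2 - eps)) as [Q1|Q1]; [|nra].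
          destruct (Rle_or_lt (-(2 - eps)) (q m)) as [Q2|Q2]; [|nra].
          exfalso. apply Gm, HG. lra. }
        destruct (Nat.leb m B); lra. }
    assert (4 * eps * s <= k / 2).
    { apply Rle_trans with (4 * eps * L); [apply Rmult_le_compat_l; lra|nra]. }
    assert ((INR B + 1) * (4 * (c1 / nn)) <= k / 4).
    { apply Rle_trans with ((b + 1) * nn * (4 * (c1 / nn))).
      - apply Rmult_le_compat_r; [|nra]. assert (0 < c1 / nn) by now apply Rdiv_lt_0_compat. lra.
      - apply Req_le. unfold c1. field. lra. }
    fold k in HP. lra. }
  destruct big as [m0 [Gm0 Hm0]].
  set (E := fun m => v (S m) ^ 2 + v m ^ 2 - q m * v m * v (S m)).
  assert (Elow : forall x y z, -(2 - eps) <= z <= 2 - eps ->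
    eps / 2 * (x ^ 2 + y ^ 2) <= x ^ 2 + y ^ 2 - z * x * y).
  { intros x y z Hz.
    assert (0 <= (2 - eps + z) * (x - y) ^ 2) by (apply Rmult_le_pos; [lra|apply pow2_ge_0]).
    assert (0 <= (2 - eps - z) * (x + y) ^ 2) by (apply Rmult_le_pos; [lra|apply pow2_ge_0]).
    lra. }
  assert (step : forall m, G m -> G (S m) ->
    E m <= (1 + h / nn) * E (S m) /\ E (S m) <= (1 + h / nn) * E m).
  { intros m G1 G2.
    assert (rec := coefV_rec r n (S m) (proj1 Hr)). fold v nn in rec. fold (q (S m)) in rec.
    simpl shift in rec.
    (* By the recurrence, E (S m) is the form E m with q (S m) in place of q m; only the slow
       variation of q changes the energy. *)
    assert (EE : E (S m) = v (S m) ^ 2 + v m ^ 2 - q (S m) * v (S m) * v m).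
    { unfold E. replace (v (S (S m))) with (q (S m) * v (S m) - v m) by lra. ring. }
    assert (L1 := Elow (v (S m)) (v m) (q (S m)) (proj1 (HG _) G2)).
    assert (L2 := Elow (v m) (v (S m)) (q m) (proj1 (HG _) G1)).
    rewrite <- EE in L1.
    replace (v m ^ 2 + v (S m) ^ 2 - q m * v m * v (S m)) with (E m) in L2 by (unfold E; ring).
    assert (Dq : 0 <= q m - q (S m) <= h * eps / nn).
    { destruct G1 as [G1 _]. set (x := INR (S m)) in *.
      assert (Hx : 0 < x) by (apply lt_0_INR; lia).
      assert (Eq : q m - q (S m) = (1 - r ^ 2) * nn / (r * x * (x + 1))).
      { unfold q, rec_coef. rewrite (S_INR (S m)). fold x. field. lra. }
      rewrite Eq. split.
      - left. apply Rdiv_lt_0_compat; [nra|]. repeat apply Rmult_lt_0_compat; lra.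
      - replace (h * eps / nn) with ((1 - r ^ 2) * nn / (r * (a * nn) * (a * nn)))
          by (unfold h; field; lra).
        apply Rmult_le_compat_l; [nra|]. apply Rinv_le_contravar.
        + assert (0 < a * nn) by (apply Rmult_lt_0_compat; lra).
          repeat apply Rmult_lt_0_compat; lra.
        + assert (0 < a * nn) by (apply Rmult_lt_0_compat; lra).
          apply Rmult_le_compat; try nra. }
    set (d := q m - q (S m)) in *.
    assert (ED : E (S m) - E m = d * (v m * v (S m))) by (unfold d; rewrite EE; unfold E; ring).
    set (y := v m * v (S m)) in *.
    assert (Y1 : 2 * Rabs y <= v m ^ 2 + v (S m) ^ 2).
    { unfold y. assert (0 <= (v m - v (S m)) ^ 2) by apply pow2_ge_0.
      assert (0 <= (v m + v (S m)) ^ 2) by apply pow2_ge_0.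
      unfold Rabs. destruct (Rcase_abs _); lra. }
    assert (Y2 : eps * Rabs y <= E m) by nra.
    assert (Y3 : eps * Rabs y <= E (S m)) by nra.
    assert (Dy : Rabs (d * y) <= h / nn * (eps * Rabs y)).
    { rewrite Rabs_mult, (Rabs_pos_eq d) by lra.
      replace (h / nn * (eps * Rabs y)) with (h * eps / nn * Rabs y) by (field; lra).
      apply Rmult_le_compat_r; [apply Rabs_pos|lra]. }
    rewrite <- ED in Dy. apply Rabs_le_between in Dy.
    assert (Hhn : 0 < h / nn) by now apply Rdiv_lt_0_compat.
    split; nra. }
  assert (chain : forall d m, G m -> G (m + d)%nat ->
    E m <= (1 + h / nn) ^ d * E (m + d)%nat /\ E (m + d)%nat <= (1 + h / nn) ^ d * E m).
  { assert (Hhn : 0 < h / nn) by now apply Rdiv_lt_0_compat.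
    intros d. induction d as [|d IH]; intros m G1 G2.
    - rewrite Nat.add_0_r. simpl. lra.
    - replace (m + S d)%nat with (S (m + d)) in * by lia.
      assert (G3 : G (m + d)%nat).
      { unfold G in *. destruct G1 as [G1 _]. destruct G2 as [_ G2]. split.
        - eapply Rle_trans; [exact G1|]. apply le_INR. lia.
        - eapply Rle_trans; [|exact G2]. apply le_INR. lia. }
      destruct (IH m G1 G3) as [I1 I2]. destruct (step (m + d)%nat G3 G2) as [S1 S2].
      assert (0 < (1 + h / nn) ^ d) by (apply pow_lt; lra).
      simpl pow. split.
      + eapply Rle_trans; [exact I1|].
        replace ((1 + h / nn) * (1 + h / nn) ^ d * E (S (m + d))) with
          ((1 + h / nn) ^ d * ((1 + h / nn) * E (S (m + d)))) by ring.
        apply Rmult_le_compat_l; lra.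
      + eapply Rle_trans; [exact S2|].
        rewrite Rmult_assoc. apply Rmult_le_compat_l; lra. }
  assert (powb : forall d m, G (m + d)%nat -> (1 + h / nn) ^ d <= exp (h * b)).
  { intros d m [_ G2].
    assert (Hhn : 0 < h / nn) by now apply Rdiv_lt_0_compat.
    apply Rle_trans with (exp (h / nn) ^ d).
    - apply pow_incr. split; [lra|]. apply exp_ineq1_le.
    - rewrite <- Rpower_pow by apply exp_pos. unfold Rpower. rewrite ln_exp.
      assert (Hd : INR d <= b * nn).
      { eapply Rle_trans; [|exact G2]. apply le_INR. lia. }
      assert (INR d * (h / nn) <= h * b).
      { replace (h * b) with (b * nn * (h / nn)) by (field; lra).
        apply Rmult_le_compat_r; lra. }
      destruct H as [H|H]; [left; now apply exp_increasing|right; now rewrite H]. }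
  intros m Gm.
  assert (Epos : forall j, G j -> 0 <= E j).
  { intros j Gj. assert (L0 := Elow (v j) (v (S j)) (q j) (proj1 (HG _) Gj)).
    assert (0 <= v j ^ 2) by apply pow2_ge_0. assert (0 <= v (S j) ^ 2) by apply pow2_ge_0.
    unfold E. nra. }
  assert (cmp : E m0 <= exp (h * b) * E m).
  { destruct (Nat.le_ge_cases m0 m) as [Lm|Lm].
    - replace m with (m0 + (m - m0))%nat in * by lia.
      eapply Rle_trans; [apply (proj1 (chain (m - m0)%nat m0 Gm0 Gm))|].
      apply Rmult_le_compat_r; [now apply Epos|]. now apply (powb _ m0).
    - assert (Gm0' : G (m + (m0 - m))%nat) by now replace (m + (m0 - m))%nat with m0 by lia.
      destruct (chain (m0 - m)%nat m Gm Gm0') as [_ C2].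
      replace (m + (m0 - m))%nat with m0 in C2 by lia.
      eapply Rle_trans; [exact C2|].
      apply Rmult_le_compat_r; [now apply Epos|]. now apply (powb _ m). }
  assert (low : eps / 2 * (c1 / nn) <= E m0).
  { assert (L0 := Elow (v m0) (v (S m0)) (q m0) (proj1 (HG _) Gm0)).
    assert (0 <= v (S m0) ^ 2) by apply pow2_ge_0. unfold E. nra. }
  assert (up : E m <= 2 * (v m ^ 2 + v (S m) ^ 2)).
  { assert (L0 := Elow (v m) (- v (S m)) (q m) (proj1 (HG _) Gm)).
    assert (0 <= v m ^ 2) by apply pow2_ge_0. assert (0 <= v (S m) ^ 2) by apply pow2_ge_0.
    unfold E. nra. }
  assert (X : 0 < exp (h * b)) by apply exp_pos.
  rewrite exp_Ropp.
  apply Rmult_le_reg_l with (2 * exp (h * b)); [lra|].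
  replace (2 * exp (h * b) * (eps / 4 * c1 * / exp (h * b) / nn)) with (eps / 2 * (c1 / nn))
    by (field; lra).
  apply Rle_trans with (exp (h * b) * E m); [lra|].
  rewrite (Rmult_comm 2), Rmult_assoc. apply Rmult_le_compat_l; lra.
Qed.

(** The energy bound read along a row and along a column. By [coefV_deriv] the two differ by factors
    (j + 1) / (n + 1), at most b + 1 here, hence the division by (b + 1)^2. *)
Lemma bulk_lower (r : R) :
  0 < r < 1 ->
  exists a b c, 0 < a < b /\ 0 < c /\ forall n k, (0 < n)%nat ->
    a * INR n <= INR k <= b * INR n ->
    c / INR n <= coef r k n ^ 2 + coef r (S k) n ^ 2 /\
    c / INR n <= coef r n k ^ 2 + coef r n (S k) ^ 2.
Proof.
  intros Hr. destruct (bulk_energy r Hr) as [a [b [c [Hab [Hc H]]]]].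
  set (d := (b + 1) ^ 2).
  assert (Hd : 1 <= d) by (unfold d; nra).
  exists a, b, (c / d).
  assert (Hcd : 0 < c / d <= c).
  { split; [apply Rdiv_lt_0_compat; lra|].
    apply Rmult_le_reg_r with d; [lra|]. unfold Rdiv. rewrite Rmult_assoc, Rinv_l by lra. nra. }
  split; [exact Hab|]. split; [lra|].
  intros n k Hn Hk. destruct n as [|n]; [lia|].
  assert (Pn : 0 < INR (S n)) by (apply lt_0_INR; lia).
  destruct k as [|k].
  { exfalso. simpl in Hk. assert (0 < a * INR (S n)) by (apply Rmult_lt_0_compat; lra).
    simpl in H0. lra. }
  assert (B := H n k Hk).
  assert (Hcn : c / d / INR (S n) <= c / INR (S n)).
  { apply Rmult_le_compat_r; [left; now apply Rinv_0_lt_compat|lra]. }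
  split.
  - rewrite <- !coefV_sq. lra.
  - assert (col : forall j, (j <= S k)%nat -> coefV r n j ^ 2 <= d * coef r (S n) (S j) ^ 2).
    { intros j Hj. assert (E := coefV_deriv r n j).
      assert (Pj : 0 < INR (S j)) by (apply lt_0_INR; lia).
      replace (coefV r n j) with (INR (S j) / INR (S n) * coef r (S n) (S j)).
      2: { apply Rmult_eq_reg_l with (INR (S n)); [|lra]. rewrite <- E. field. lra. }
      rewrite Rpow_mult_distr. apply Rmult_le_compat_r; [apply pow2_ge_0|].
      unfold d. apply pow_incr. split.
      - left. now apply Rdiv_lt_0_compat.
      - apply Rmult_le_reg_r with (INR (S n)); [exact Pn|].
        unfold Rdiv. rewrite Rmult_assoc, Rinv_l by lra.
        assert (J : INR (S j) <= INR (S k) + 1) by (rewrite <- S_INR; apply le_INR; lia).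
        assert (1 <= INR (S n)) by (apply (le_INR 1); lia). nra. }
    assert (C1 := col k ltac:(lia)). assert (C2 := col (S k) (le_n _)).
    apply Rmult_le_reg_l with d; [lra|].
    replace (d * (c / d / INR (S n))) with (c / INR (S n)) by (field; lra). lra.
Qed.

(** * Comparison of weights with overlapping bulks, and chaining *)

Lemma sum_n_window (f : nat -> R) (t : R) (k d : nat) :
  (forall j, 0 <= f j) -> (forall j, (k <= j <= k + d)%nat -> t <= f j) ->
  INR (S d) * t <= sum_n f (k + d).
Proof.
  intros Hf. induction d as [|d IH]; intros H.
  - rewrite Rmult_1_l. eapply Rle_trans; [apply (H k); lia|]. apply sum_n_ge_term; [exact Hf|lia].
  - rewrite Nat.add_succ_r, sum_n_SR, S_INR, Rmult_plus_distr_r, Rmult_1_l.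
    apply Rplus_le_compat; [apply IH; intros; apply H; lia|apply H; lia].
Qed.

Lemma real_window (x y : R) :
  0 <= x -> x + 1 <= y ->
  exists k d, x <= INR k /\ INR (k + d) <= y /\ y - x - 1 <= INR (S d).
Proof.
  intros Hx Hy. destruct (nfloor_ex x Hx) as [k [Hk1 Hk2]].
  destruct (nfloor_ex (y - x - 1) ltac:(lra)) as [d [Hd1 Hd2]].
  exists (S k), d. rewrite plus_INR, !S_INR. lra.
Qed.

Lemma bulk_comparable (r : R) (beta : nat -> R) (M : R) :
  0 < r < 1 -> (forall n, 0 < beta n) -> 0 < M -> fin_bounded r beta M ->
  exists eta K n0, 0 < eta /\ 0 < K /\ forall n p p',
    (n0 <= n)%nat -> (n <= p)%nat -> (n <= p')%nat ->
    INR p <= (1 + eta) * INR n -> INR p' <= (1 + eta) * INR n ->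
    beta p <= K * beta p'.
Proof.
  intros Hr Hb HM HF.
  destruct (adjacent_comparable r beta M Hr Hb HM HF) as [D [HD1 HD]].
  destruct (bulk_lower r Hr) as [a [b [c [Hab [Hc HB]]]]].
  (* With this eta the interval from (a + b) n / 2 to b n lies in the bulk of every q between n and
     (1 + eta) n. *)
  set (eta := (b - a) / (2 * a)).
  assert (Heta : 0 < eta) by (apply Rdiv_lt_0_compat; lra).
  assert (Ea : a * (1 + eta) = (a + b) / 2) by (unfold eta; field; lra).
  (* Beyond [n1], (b - a) n >= 4, so that interval contains at least (b - a) n / 4 integers. *)
  destruct (nfloor_ex (4 / (b - a)) ltac:(left; apply Rdiv_lt_0_compat; lra)) as [n1 [_ Hn1]].
  (* The 2 comes from squaring a sum of two entries, the factor 1 + D from moving the weight of the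
     second one to the neighbouring index. *)
  set (A := 2 * (1 + D) * M).
  assert (HA : 0 < A) by (unfold A; nra).
  (* At least (b - a) n / 4 indices, each contributing at least c / ((1 + eta) n). *)
  set (delta := (b - a) / 4 * (c / (1 + eta))).
  assert (Hdelta : 0 < delta).
  { apply Rmult_lt_0_compat; [lra|]. apply Rdiv_lt_0_compat; lra. }
  exists eta, (A * A / delta ^ 2), (S n1). split; [exact Heta|].
  split; [apply Rdiv_lt_0_compat; [now apply Rmult_lt_0_compat|now apply pow_lt]|].
  intros n p p' Hn Hp Hp' Hpe Hpe'.
  assert (Hnr : 4 / (b - a) <= INR n).
  { apply le_INR in Hn. rewrite S_INR in Hn. lra. }
  assert (Hn4 : 4 <= (b - a) * INR n).
  { apply Rmult_le_compat_l with (r := b - a) in Hnr; [|lra].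
    replace ((b - a) * (4 / (b - a))) with 4 in Hnr by (field; lra). exact Hnr. }
  assert (Pn : 0 < INR n) by (apply lt_0_INR; lia).
  destruct (real_window ((a + b) / 2 * INR n) (b * INR n)) as [k [d [W1 [W2 W3]]]];
    [nra|nra|].
  assert (inb : forall q j, (n <= q)%nat -> INR q <= (1 + eta) * INR n -> (k <= j <= k + d)%nat ->
    a * INR q <= INR j <= b * INR q).
  { intros q j Hq Hqe [J1 J2]. apply le_INR in J1. apply le_INR in J2. apply le_INR in Hq.
    split.
    - apply Rle_trans with (a * ((1 + eta) * INR n)); [apply Rmult_le_compat_l; lra|].
      rewrite <- Rmult_assoc, Ea. lra.
    - apply Rle_trans with (b * INR n); [lra|]. apply Rmult_le_compat_l; lra. }
  set (P := fun j => Rabs (coef r j p) + Rabs (coef r (S j) p)).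
  set (Q := fun j => Rabs (coef r p' j) + Rabs (coef r p' (S j))).
  assert (sq : forall u v, u ^ 2 + v ^ 2 <= (Rabs u + Rabs v) ^ 2 <= 2 * (u ^ 2 + v ^ 2)).
  { intros u v. rewrite <- (pow2_abs u), <- (pow2_abs v).
    assert (0 <= Rabs u) by apply Rabs_pos. assert (0 <= Rabs v) by apply Rabs_pos.
    assert (0 <= (Rabs u - Rabs v) ^ 2) by apply pow2_ge_0. nra. }
  assert (P0 : forall j, 0 <= P j).
  { intros j. unfold P. assert (0 <= Rabs (coef r j p)) by apply Rabs_pos.
    assert (0 <= Rabs (coef r (S j) p)) by apply Rabs_pos. lra. }
  assert (Q0 : forall j, 0 <= Q j).
  { intros j. unfold Q. assert (0 <= Rabs (coef r p' j)) by apply Rabs_pos.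
    assert (0 <= Rabs (coef r p' (S j))) by apply Rabs_pos. lra. }
  set (t := c / ((1 + eta) * INR n)).
  assert (Ht : 0 < t).
  { apply Rdiv_lt_0_compat; [exact Hc|]. apply Rmult_lt_0_compat; lra. }
  assert (tq : forall q, (n <= q)%nat -> INR q <= (1 + eta) * INR n -> t <= c / INR q).
  { intros q Hq Hqe. apply Rmult_le_compat_l; [lra|]. apply Rinv_le_contravar; [|exact Hqe].
    apply lt_0_INR. lia. }
  apply (weighted_link beta P Q (beta p) (beta p') A A delta (S (k + d)) Hb (Hb p) (Hb p') Hdelta).
  - apply Rle_trans with (sum_n (fun j => P j * Q j) (k + d)).
    2: { apply sum_n_monotone; [|lia]. intros j. now apply Rmult_le_pos. }
    apply Rle_trans with (INR (S d) * t).
    + replace delta with ((b - a) / 4 * INR n * t) by (unfold delta, t; field; lra).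
      apply Rmult_le_compat_r; [lra|]. lra.
    + apply sum_n_window; [intros; now apply Rmult_le_pos|].
      intros j Hj.
      assert (B1 := proj1 (HB p j ltac:(lia) (inb p j Hp Hpe Hj))).
      assert (B2 := proj2 (HB p' j ltac:(lia) (inb p' j Hp' Hpe' Hj))).
      assert (S1 := proj1 (sq (coef r j p) (coef r (S j) p))). fold (P j) in S1.
      assert (S2 := proj1 (sq (coef r p' j) (coef r p' (S j)))). fold (Q j) in S2.
      assert (T1 := tq p Hp Hpe). assert (T2 := tq p' Hp' Hpe').
      assert (PP : t <= P j ^ 2) by lra. assert (QQ : t <= Q j ^ 2) by lra.
      apply Rsqr_incr_0_var; [|now apply Rmult_le_pos].
      unfold Rsqr. replace (P j * Q j * (P j * Q j)) with (P j ^ 2 * Q j ^ 2) by ring.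
      apply Rmult_le_compat; lra.
  - set (J := S (k + d)).
    assert (R1 := row_bound r beta M p J Hb HM HF).
    assert (R2 := row_bound r beta M p (S J) Hb HM HF). rewrite sum_n_head in R2.
    assert (R3 : 0 <= coef r 0 p ^ 2 / beta 0%nat).
    { apply Rmult_le_pos; [apply pow2_ge_0|left; apply Rinv_0_lt_compat, Hb]. }
    apply Rle_trans with (2 * sum_n (fun j => coef r j p ^ 2 / beta j) J +
      2 * D * sum_n (fun j => coef r (S j) p ^ 2 / beta (S j)) J).
    + rewrite <- !sum_n_scalR, <- sum_n_plusR. apply sum_n_leR. intros j _.
      assert (S1 := proj2 (sq (coef r j p) (coef r (S j) p))). fold (P j) in S1.
      assert (b0 := Hb j). assert (b1 := Hb (S j)).
      assert (I : / beta j <= D * / beta (S j)).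
      { destruct (HD j) as [_ H2]. apply Rmult_le_reg_l with (beta j * beta (S j));
          [now apply Rmult_lt_0_compat|]. field_simplify; lra. }
      assert (i0 : 0 < / beta j) by now apply Rinv_0_lt_compat.
      unfold Rdiv. apply Rle_trans with (2 * (coef r j p ^ 2 + coef r (S j) p ^ 2) * / beta j).
      * apply Rmult_le_compat_r; lra.
      * assert (0 <= coef r (S j) p ^ 2) by apply pow2_ge_0. nra.
    + replace (A / beta p) with (2 * (M / beta p) + 2 * D * (M / beta p))
        by (unfold A; field; specialize (Hb p); lra).
      apply Rplus_le_compat; apply Rmult_le_compat_l; lra.
  - set (J := S (k + d)).
    assert (R1 := col_bound r beta M p' J HF).
    assert (R2 := col_bound r beta M p' (S J) HF). rewrite sum_n_head in R2.
    assert (R3 : 0 <= beta 0%nat * coef r p' 0 ^ 2).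
    { apply Rmult_le_pos; [left; apply Hb|apply pow2_ge_0]. }
    apply Rle_trans with (2 * sum_n (fun j => beta j * coef r p' j ^ 2) J +
      2 * D * sum_n (fun j => beta (S j) * coef r p' (S j) ^ 2) J).
    + rewrite <- !sum_n_scalR, <- sum_n_plusR. apply sum_n_leR. intros j _.
      assert (S1 := proj2 (sq (coef r p' j) (coef r p' (S j)))). fold (Q j) in S1.
      assert (b0 := Hb j). destruct (HD j) as [H1 _].
      apply Rle_trans with (beta j * (2 * (coef r p' j ^ 2 + coef r p' (S j) ^ 2))).
      * apply Rmult_le_compat_l; lra.
      * assert (0 <= coef r p' (S j) ^ 2) by apply pow2_ge_0. nra.
    + replace (A * beta p') with (2 * (M * beta p') + 2 * D * (M * beta p')) by (unfold A; ring).
      apply Rplus_le_compat; apply Rmult_le_compat_l; lra.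
Qed.

Lemma chain_comparable (beta : nat -> R) (K : R) (n d : nat) :
  0 < K -> (forall q p, (n <= q)%nat -> (q <= p <= q + d)%nat ->
    beta p <= K * beta q /\ beta q <= K * beta p) ->
  forall i p, (n <= p <= n + i * d)%nat ->
    beta p <= K ^ i * beta n /\ beta n <= K ^ i * beta p.
Proof.
  intros HK H i. induction i as [|i IH]; intros p Hp.
  - replace p with n by lia. simpl. lra.
  - set (q := Nat.max n (p - d)).
    destruct (IH q ltac:(unfold q; lia)) as [I1 I2].
    destruct (H q p ltac:(unfold q; lia) ltac:(unfold q; lia)) as [S1 S2].
    assert (0 < K ^ i) by now apply pow_lt. simpl pow. split; nra.
Qed.

Lemma fin_bounded_doubling (r : R) (beta : nat -> R) (M : R) :
  0 < r < 1 -> (forall n, 0 < beta n) -> 0 < M -> fin_bounded r beta M ->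
  exists D, doubling beta D.
Proof.
  intros Hr Hb HM HF.
  destruct (adjacent_comparable r beta M Hr Hb HM HF) as [D [HD1 HD]].
  destruct (bulk_comparable r beta M Hr Hb HM HF) as [eta [K [n0 [Heta [HK HC]]]]].
  (* h exceeds 1 / eta, so a step of length [n / h] from any q >= n stays below (1 + eta) q. *)
  destruct (nfloor_ex (/ eta) ltac:(left; now apply Rinv_0_lt_compat)) as [h0 [_ Hh0]].
  set (h := S h0).
  assert (Hh : / INR h <= eta).
  { rewrite <- (Rinv_inv eta). apply Rinv_le_contravar; [now apply Rinv_0_lt_compat|].
    unfold h. rewrite S_INR. lra. }
  assert (Hh1 : 0 < INR h) by (apply lt_0_INR; unfold h; lia).
  set (n1 := (n0 + h)%nat).
  set (D1 := 1 + D ^ n1 + K ^ (2 * h)).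
  assert (pD : 0 < D ^ n1) by (apply pow_lt; lra).
  assert (pK : 0 < K ^ (2 * h)) by now apply pow_lt.
  assert (main : forall n p, (n <= p <= 2 * n)%nat -> beta p <= D1 * beta n /\ beta n <= D1 * beta p).
  { intros n p Hp.
    assert (Bn := Hb n). assert (Bp := Hb p).
    destruct (Nat.le_gt_cases n1 n) as [L|L].
    - assert (cmp : forall q p', (n <= q)%nat -> (q <= p' <= q + n / h)%nat ->
        beta p' <= K * beta q /\ beta q <= K * beta p').
      { intros q p' Hq Hp'.
        assert (E : INR p' <= (1 + eta) * INR q).
        { assert (Hd : (n / h <= q / h)%nat) by (apply Nat.Div0.div_le_mono; exact Hq).
          assert (Hm : (h * (q / h) <= q)%nat) by (apply Nat.Div0.mul_div_le).
          assert (X : INR p' <= INR q + INR (q / h)) by (rewrite <- plus_INR; apply le_INR; lia).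
          apply le_INR in Hm. rewrite mult_INR in Hm.
          assert (Y : INR (q / h) <= / INR h * INR q).
          { apply Rmult_le_reg_l with (INR h); [exact Hh1|].
            rewrite <- Rmult_assoc, Rinv_r by lra. lra. }
          assert (0 <= INR q) by apply pos_INR. nra. }
        assert (E' : INR q <= (1 + eta) * INR q) by (assert (0 <= INR q) by apply pos_INR; nra).
        split; apply (HC q); auto; unfold n1 in L; lia. }
      (* Since [n / h] is at least 1, the remainder of the division is less than h times the
         quotient; hence 2 h steps cover the distance n. *)
      assert (Hcov : (2 * n <= n + 2 * h * (n / h))%nat).
      { assert (M1 := Nat.div_mod_eq n h).
        assert (M2 := Nat.mod_upper_bound n h ltac:(unfold h; lia)).
        assert (M3 : (0 < n / h)%nat) by (apply Nat.div_str_pos; unfold n1, h in *; lia). nia. }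
      destruct (chain_comparable beta K n (n / h) HK cmp (2 * h) p ltac:(lia)) as [C1 C2].
      split; (eapply Rle_trans; [eassumption|]; apply Rmult_le_compat_r; unfold D1; lra).
    (* Below [n1] unit steps are enough, as the distance from n to p is at most n < n1. *)
    - destruct (chain_comparable beta D n 1 ltac:(lra)) with (i := n1) (p := p) as [C1 C2].
      + intros q p' _ Hp'. destruct (Nat.eq_dec p' q) as [->|Ne].
        * assert (Bq := Hb q). split; nra.
        * replace p' with (S q) by lia. destruct (HD q); split; assumption.
      + lia.
      + split; (eapply Rle_trans; [eassumption|]; apply Rmult_le_compat_r; unfold D1; lra). }
  exists D1. intros m n H1 H2.
  destruct (Nat.le_ge_cases m n) as [L|L]; [apply (main m n)|apply (main n m)]; lia.
Qed.

Lemma slowly_oscillating_iff (beta : nat -> R) :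
  (forall n, 0 < beta n) -> (slowly_oscillating beta <-> exists D, doubling beta D).
Proof.
  intros Hb. split.
  - intros [c1 [c2 [Hc1 [Hc2 H]]]]. exists c2. intros m n H1 H2.
    apply le_INR in H1. apply le_INR in H2. rewrite mult_INR in H1, H2. simpl INR in H1, H2.
    destruct (H m n ltac:(lra)) as [_ B]. assert (Bn := Hb n).
    replace (beta m) with (beta m / beta n * beta n) by (field; lra).
    apply Rmult_le_compat_r; lra.
  - intros [D HD]. assert (HD1 := doubling_pos beta D Hb HD).
    (* D may equal 1, while the two constants must lie strictly on either side of 1. *)
    exists (/ (D + 1)), (D + 1). split; [|split; [lra|]].
    { split; [apply Rinv_0_lt_compat; lra|]. rewrite <- Rinv_1. apply Rinv_lt_contravar; lra. }
    intros m n Hmn. assert (Bn := Hb n). assert (Bm := Hb m).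
    assert (H1 : (m <= 2 * n)%nat) by (apply INR_le; rewrite mult_INR; simpl INR at 2; lra).
    assert (H2 : (n <= 2 * m)%nat) by (apply INR_le; rewrite mult_INR; simpl INR at 2; lra).
    assert (U := HD m n H2 H1). assert (V := HD n m H1 H2).
    split; (apply Rmult_le_reg_r with (beta n); [exact Bn|]);
      replace (beta m / beta n * beta n) with (beta m) by (field; lra); [|nra].
    apply Rmult_le_reg_l with (D + 1); [lra|].
    rewrite <- Rmult_assoc, Rinv_r by lra. nra.
Qed.

Theorem theorem1p1 :
  forall beta : nat -> R, admissible_weight beta ->
    ((exists a : C, unit_disk a /\ a <> RtoC 0 /\ bounded_comp_op beta (T a))
     <-> (forall a : C, unit_disk a -> bounded_comp_op beta (T a)))
    /\
    ((forall a : C, unit_disk a -> bounded_comp_op beta (T a))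
     <-> slowly_oscillating beta).
Proof.
  intros beta [Hb _].
  assert (H13 : (exists a : C, unit_disk a /\ a <> RtoC 0 /\ bounded_comp_op beta (T a)) ->
    slowly_oscillating beta).
  { intros [a [Ha [Ha0 HB]]].
    destruct (comp_op_fin_bounded beta a Hb Ha HB) as [M [HM HF]].
    apply slowly_oscillating_iff; [exact Hb|].
    apply (fin_bounded_doubling (Cmod a) beta M); try assumption.
    split; [now apply Cmod_gt_0|exact Ha]. }
  assert (H32 : slowly_oscillating beta ->
    forall a : C, unit_disk a -> bounded_comp_op beta (T a)).
  { intros Hs a Ha. apply slowly_oscillating_iff in Hs; [|exact Hb].
    destruct Hs as [D HD].
    destruct (doubling_fin_bounded (Cmod a) beta D) as [M HM]; try assumption.
    - split; [apply Cmod_ge_0|exact Ha].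
    - now apply (fin_bounded_comp_op beta a M). }
  assert (H21 : (forall a : C, unit_disk a -> bounded_comp_op beta (T a)) ->
    exists a : C, unit_disk a /\ a <> RtoC 0 /\ bounded_comp_op beta (T a)).
  { intros H. exists (RtoC (/ 2)).
    assert (U : unit_disk (RtoC (/ 2))).
    { unfold unit_disk. rewrite Cmod_R, Rabs_pos_eq; lra. }
    split; [exact U|]. split; [|now apply H].
    intros E. apply RtoC_inj in E. lra. }
  split; split; auto.
Qed.
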